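(* Let $\lambda\in\mathbb{C}$, $v=(v_1,\ldots,v_n)\in\mathbb{R}^n$, $v\neq 0$, and let $K\subset\mathbb{R}^n$ be a compact, $v$-normal set with a smooth surface. Then the differential operator $\sum_{j=1}^n v_jD_j-\lambda:\mathcal{E}(K)\to\mathcal{E}(K)$ admits a continuous linear right inverse, i.e. there is a continuous linear operator $S:\mathcal{E}(K)\to\mathcal{E}(K)$ with $\left(\sum_{j=1}^n v_jD_j-\lambda\right)\circ S=\operatorname{id}_{\mathcal{E}(K)}$.
   Context: Fix $n\in\mathbb{N}$. $\mathcal{E}(\mathbb{R}^n)$ is the space of smooth complex-valued functions on $\mathbb{R}^n$ with its natural Fréchet topology (uniform convergence of all derivatives on compact sets); $D_j=\partial/\partial x_j$ and $D^\beta=D_1^{\beta_1}\cdots D_n^{\beta_n}$ for $\beta\in\mathbb{N}_0^n$. For a compact set $K\subset\mathbb{R}^n$ let $r_K:\mathcal{E}(\mathbb{R}^n)\to\prod_{\beta\in\mathbb{N}_0^n}C(K)$, $r_KF=((D^\beta F)|_K)_{\beta\in\mathbb{N}_0^n}$. The space of Whitney functions on $K$ is $\mathcal{E}(K)=\{f=(f^\beta)_{\beta\in\mathbb{N}_0^n}: r_KF=f \text{ for some } F\in\mathcal{E}(\mathbb{R}^n)\}$, with the finest topology making $r_K:\mathcal{E}(\mathbb{R}^n)\to\mathcal{E}(K)$ continuous (the quotient topology); it is a Fréchet space. On $\mathcal{E}(K)$ one sets $D_jf=(f^{\beta+e_j})_{\beta\in\mathbb{N}_0^n}$, where $e_j$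 is the $j$-th standard unit vector. For $v\in\mathbb{R}^n$ let $H_v=\{x\in\mathbb{R}^n:\langle x,v\rangle=0\}$, where $\langle\cdot,\cdot\rangle$ is the standard scalar product. A set $K\subset\mathbb{R}^n$ is $v$-normal if there exist a compact set $K_v\subset H_v$ and functions $\phi_v,\psi_v:K_v\to\mathbb{R}$ with $\phi_v\le\psi_v$ such that $K=\{tv+x: x\in K_v,\ t\in[\phi_v(x),\psi_v(x)]\}$. It is $v$-normal with a smooth surface if moreover there exists $\gamma_v=(\gamma_v^\beta)_\beta\in\mathcal{E}(K_v)$ (Whitney functions on the compact subset $K_v$ of $\mathbb{R}^n$) such that $\phi_v\le\gamma_v^0\le\psi_v$ on $K_v$. *)

(* Defs.v *)
From HB Require Import structures.
From mathcomp Require Import all_boot all_order all_algebra.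
From mathcomp Require Import complex.
From mathcomp Require Import boolp classical_sets functions reals.
From mathcomp Require Import topology normedtype derive.
Set Implicit Arguments.
Unset Strict Implicit.
Unset Printing Implicit Defensive.
Import Order.TTheory GRing.Theory Num.Theory.
Import numFieldNormedType.Exports.
Local Open Scope classical_set_scope.
Local Open Scope ring_scope.
Local Open Scope complex_scope.

Definition mindex (n : nat) := {ffun 'I_n -> nat}.

Definition mindex0 (n : nat) : mindex n := [ffun=> 0%N].

Definition mindexS (n : nat) (b : mindex n) (j : 'I_n) : mindex n :=
  [ffun i => (b i + (i == j))%N].

Section RealPartials.
Variables (R : realType) (n : nat).
Implicit Types (f g : 'rV[R]_n -> R) (x : 'rV[R]_n) (i j : 'I_n).

Definition ebase j : 'rV[R]_n := delta_mx 0 j.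

Definition partial j f : 'rV[R]_n -> R := 'D_(ebase j) f.

(* [partials [:: j1; ...; jk] f] is [D_j1 (... (D_jk f))]. *)
Definition partials (s : seq 'I_n) f := foldr partial f s.

(* [D_0^(b 0) (... (D_(n-1)^(b (n-1)) f))]. *)
Definition mpartial (b : mindex n) f : 'rV[R]_n -> R :=
  foldr (fun j => iter (b j) (partial j)) f (enum 'I_n).

(* All iterated partial derivatives, in every order, exist and are continuous. *)
Definition smoothr f := forall s : seq 'I_n,
  continuous (partials s f) /\
  forall j x, derivable (partials s f) x (ebase j).

Lemma partials_cat s t f : partials (s ++ t) f = partials s (partials t f).
Proof. exact: foldr_cat. Qed.

Lemma smoothr_partials s f : smoothr f -> smoothr (partials s f).
Proof. by move=> sf t; rewrite -partials_cat; exact: sf. Qed.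

Lemma partials_lin s (a : R) f g : smoothr f -> smoothr g ->
  partials s (fun x => a * f x + g x) =
  (fun x => a * partials s f x + partials s g x).
Proof.
move=> sf sg; elim: s => //= j s ->; apply/funext => x.
have df := proj2 (sf s) j x.
have dg := proj2 (sg s) j x.
have da := @derivableZ _ _ _ _ a _ _ df.
by rewrite /partial (deriveD da dg) (deriveZ _ df).
Qed.

Lemma smoothr_lin (a : R) f g : smoothr f -> smoothr g ->
  smoothr (fun x => a * f x + g x).
Proof.
move=> sf sg s; rewrite partials_lin//.
have [cf df] := sf s; have [cg dg] := sg s; split=> [x|j x].
  apply: (@continuousD _ _ _ (a \*: partials s f) (partials s g)); last exact: cg.
  by apply: continuousZr; exact: cf.
by apply: derivableD => //; exact: (@derivableZ _ _ _ _ a _ _ (df j x)).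
Qed.

Lemma partials_cst0 s : partials s (fun=> 0) = (fun=> 0).
Proof. by elim: s => //= j s ->; apply/funext => x; exact: derive_cst. Qed.

Lemma smoothr0 : smoothr (fun=> 0).
Proof.
move=> s; rewrite partials_cst0; split=> [|j x]; last exact: derivable_cst.
exact: cst_continuous.
Qed.

Lemma is_derive_line f x (e : 'rV[R]_n) (t : R) :
  derivable f (x + t *: e) e ->
  is_derive t 1 (fun s : R => f (x + s *: e)) ('D_e f (x + t *: e)).
Proof.
move=> df.
have E : (fun h : R => h^-1 *: (f (x + (h *: (1 : R) + t) *: e) - f (x + t *: e)))
       = (fun h : R => h^-1 *: (f (h *: e + (x + t *: e)) - f (x + t *: e))).
  apply/funext => h; congr (_ *: (f _ - _)).
  by rewrite [h *: (1 : R)]mulr1 scalerDl addrCA.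
by split; rewrite /derivable /derive /= E.
Qed.

Lemma mvt_line f x (e : 'rV[R]_n) (h : R) : 0 < h ->
  (forall y, derivable f y e) ->
  exists2 c, 0 < c < h & f (x + h *: e) - f x = h * 'D_e f (x + c *: e).
Proof.
move=> h0 df.
have D (t : R) := is_derive_line (df (x + t *: e)).
have C : {within `[0, h], continuous (fun s => f (x + s *: e))}.
  apply: derivable_within_continuous => t _.
  by have [] := D t.
have [c] := @MVT R (fun s => f (x + s *: e)) (fun t => 'D_e f (x + t *: e))
  0 h h0 (fun t _ => D t) C.
by rewrite in_itv/= scale0r addr0 subr0 => hc ->; exists c; rewrite // mulrC.
Qed.

Lemma mixed_difference f i j x (h : R) : smoothr f -> 0 < h ->
  exists s t, [/\ 0 < s < h, 0 < t < h &
    f (x + h *: ebase i + h *: ebase j) - f (x + h *: ebase i)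
      - f (x + h *: ebase j) + f x =
    h * h * partial j (partial i f) (x + s *: ebase i + t *: ebase j)].
Proof.
move=> sf h0.
have df k y : derivable f y (ebase k) by have [_] := sf [::]; exact.
pose u y := f (y + h *: ebase j) - f y.
have shE y : (fun k : R => k^-1 *: (f (k *: ebase i + y + h *: ebase j) -
    f (y + h *: ebase j))) = (fun k : R => k^-1 *:
    (f (k *: ebase i + (y + h *: ebase j)) - f (y + h *: ebase j))).
  by apply/funext => k; rewrite addrA.
have dsh y : derivable (fun z => f (z + h *: ebase j)) y (ebase i).
  by rewrite /derivable /= shE; exact: df.
have Dsh y : 'D_(ebase i) (fun z => f (z + h *: ebase j)) y =
             'D_(ebase i) f (y + h *: ebase j).
  by rewrite /derive /= shE.
have du y : derivable u y (ebase i) by exact: derivableB.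
have [s hs Es] := mvt_line x h0 du.
have dif y : derivable (partial i f) y (ebase j) by have [_] := sf [:: i]; exact.
have [t ht Et] := mvt_line (x + s *: ebase i) h0 dif.
exists s, t; split => //.
have -> : f (x + h *: ebase i + h *: ebase j) - f (x + h *: ebase i)
  - f (x + h *: ebase j) + f x = u (x + h *: ebase i) - u x.
  by rewrite /u opprB addrA addrAC.
by rewrite Es (deriveB (dsh _) (df _ _)) Dsh Et mulrA.
Qed.

Lemma schwarz f i j : smoothr f -> partial i (partial j f) = partial j (partial i f).
Proof.
move=> sf; apply/funext => x; apply/eqP; rewrite -subr_eq0; apply/negPn/negP => ne.
pose A := partial i (partial j f); pose B := partial j (partial i f).
pose e := `|A x - B x| / 2.
have e0 : 0 < e by rewrite divr_gt0// normr_gt0.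
have cA : continuous A by have [] := sf [:: i; j].
have cB : continuous B by have [] := sf [:: j; i].
have /cvgrPdist_lt /(_ e e0) NA := cA x; have /cvgrPdist_lt /(_ e e0) NB := cB x.
have [d /= d0 dP] : exists2 d : R, 0 < d & forall y, `|x - y| < d ->
    `|A x - A y| < e /\ `|B x - B y| < e.
  have : \forall y \near x, `|A x - A y| < e /\ `|B x - B y| < e.
    exact: filterI NA NB.
  move=> /nbhs_normP[d /= d0 dP]; exists d; first exact: d0.
  by move=> y xy; exact: (dP y xy).
pose M := `|ebase i| + `|ebase j| + 1.
have M0 : 0 < M by rewrite ltr_wpDl ?addr_ge0.
pose h := d / M.
have h0 : 0 < h by rewrite divr_gt0.
have near k l (s t : R) : `|ebase k| + `|ebase l| + 1 = M ->
    0 < s < h -> 0 < t < h -> `|x - (x + s *: ebase k + t *: ebase l)| < d.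
  move=> kl /andP[s0 sh] /andP[t0 th].
  rewrite -addrA opprD addrA subrr sub0r normrN.
  apply: le_lt_trans (ler_normD _ _) _; rewrite !normrZ !gtr0_norm//.
  have -> : d = h * (`|ebase k| + `|ebase l| + 1) by rewrite kl /h divfK// gt_eqF.
  rewrite mulrDr mulr1 mulrDr; apply: ltr_pwDr => //.
    by apply: lerD; rewrite ler_wpM2r// ltW.
have [s [t [hs ht Eij]]] := mixed_difference i j x sf h0.
have [s' [t' [hs' ht' Eji]]] := mixed_difference j i x sf h0.
have hh0 : h * h != 0 by rewrite mulf_neq0// gt_eqF.
have Exy : B (x + s *: ebase i + t *: ebase j) =
           A (x + s' *: ebase j + t' *: ebase i).
  apply: (mulfI hh0); apply: etrans (esym Eij) _; apply: etrans _ Eji.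
  by rewrite (addrAC x (h *: ebase j)); congr (_ + _); exact: addrAC.
have [_ H1] := dP _ (near i j s t erefl hs ht).
have [H2 _] := dP _ (near j i s' t' (congr1 (+%R^~ 1) (addrC _ _)) hs' ht').
have : `|A x - B x| < e + e.
  apply: le_lt_trans (ler_distD (A (x + s' *: ebase j + t' *: ebase i)) _ _) _.
  by apply: ltrD; [exact: H2|rewrite -Exy distrC; exact: H1].
by rewrite -splitr ltxx.
Qed.

Lemma partials_rcons s j f : smoothr f -> partials (rcons s j) f = partials (j :: s) f.
Proof.
move=> sf; elim: s => //= a s IH.
by rewrite IH /= (schwarz _ _ (smoothr_partials s sf)).
Qed.

Lemma partials_perm s t f : smoothr f -> perm_eq s t -> partials s f = partials t f.
Proof.
move=> sf; elim: s t => [|a s IH] t; first by move/perm_size/esym/size0nil ->.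
move=> pst; have : a \in t by rewrite -(perm_mem pst) mem_head.
move=> /path.splitPr at'; case: at' pst => t1 t2 pst.
rewrite -[in RHS]cat_rcons partials_cat.
rewrite partials_rcons; last exact: smoothr_partials.
rewrite /= -partials_cat (IH (t1 ++ t2))//.
by move: pst; rewrite perm_sym (perm_catCA t1 [:: a] t2) perm_cons perm_sym.
Qed.

Definition mword (b : mindex n) : seq 'I_n :=
  flatten [seq nseq (b j) j | j <- enum 'I_n].

Lemma mpartialE b f : mpartial b f = partials (mword b) f.
Proof.
rewrite /mpartial /mword; elim: (enum 'I_n) => //= j s ->.
by rewrite partials_cat; elim: (b j) => //= k ->.
Qed.

Lemma count_mword b i : count_mem i (mword b) = b i.
Proof.
rewrite /mword count_flatten -map_comp sumnE big_map big_enum /= (bigD1 i)//=.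
rewrite count_nseq /= eqxx mul1n big1 ?addn0// => j ji.
by rewrite count_nseq /= (negbTE ji).
Qed.

Lemma mpartialS b j f : smoothr f -> mpartial (mindexS b j) f = mpartial b (partial j f).
Proof.
move=> sf; rewrite !mpartialE -[partial j f]/(partials [:: j] f) -partials_cat.
apply: partials_perm => //; apply/allP => i _ /=.
by rewrite count_cat !count_mword ffunE /= addn0 (eq_sym i j).
Qed.

Lemma mpartial_lin b (a : R) f g : smoothr f -> smoothr g ->
  mpartial b (fun x => a * f x + g x) =
  (fun x => a * mpartial b f x + mpartial b g x).
Proof. by move=> sf sg; rewrite !mpartialE partials_lin. Qed.

End RealPartials.

Section SmoothFunctions.
Variables (R : realType) (n : nat).
Implicit Types (F G : 'rV[R]_n -> R[i]^o) (b : mindex n).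

Definition smoothc F :=
  smoothr (fun x => complex.Re (F x)) /\ smoothr (fun x => complex.Im (F x)).

(* [R[i]] is not a normed space over [R] in the library, so derivatives in the
   real directions are taken separately on the real and imaginary parts. *)
Definition cmpartial b F : 'rV[R]_n -> R[i]^o := fun x =>
  mpartial b (fun y => complex.Re (F y)) x +i*
  mpartial b (fun y => complex.Im (F y)) x.

Definition smooth_pred : {pred 'rV[R]_n -> R[i]^o} := fun F => `[< smoothc F >].

Lemma ReL (c : R[i]) F G : (fun x => complex.Re ((c *: F + G) x)) =
  (fun x => complex.Re c * complex.Re (F x) +
    (- complex.Im c * complex.Im (F x) + complex.Re (G x))).
Proof.
apply/funext => x; rewrite -[(c *: F + G) x]/(c * F x + G x).
by case: c (F x) (G x) => [? ?] [? ?] [? ?] /=; rewrite mulNr addrA.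
Qed.

Lemma ImL (c : R[i]) F G : (fun x => complex.Im ((c *: F + G) x)) =
  (fun x => complex.Re c * complex.Im (F x) +
    (complex.Im c * complex.Re (F x) + complex.Im (G x))).
Proof.
apply/funext => x; rewrite -[(c *: F + G) x]/(c * F x + G x).
by case: c (F x) (G x) => [? ?] [? ?] [? ?] /=; rewrite addrA.
Qed.

Lemma smooth_submod : submod_closed smooth_pred.
Proof.
split=> [|c F G]; first by apply/asboolP; split; exact: smoothr0.
move=> /asboolP[rF iF] /asboolP[rG iG]; apply/asboolP; split.
  rewrite ReL.
  exact: (smoothr_lin (complex.Re c) rF (smoothr_lin (- complex.Im c) iF rG)).
rewrite ImL.
exact: (smoothr_lin (complex.Re c) iF (smoothr_lin (complex.Im c) rF iG)).
Qed.

HB.instance Definition _ :=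
  GRing.isSubmodClosed.Build R[i] ('rV[R]_n -> R[i]^o) smooth_pred smooth_submod.

Record smoothfun := SmoothFun {
  sfun :> 'rV[R]_n -> R[i]^o;
  sfunP : sfun \in smooth_pred }.

HB.instance Definition _ := [isSub for sfun].
HB.instance Definition _ := [Choice of smoothfun by <:].
HB.instance Definition _ := [SubChoice_isSubLmodule of smoothfun by <:].

Definition smooth_jet (F : smoothfun) :
    prod_topology (fun _ : mindex n => {family compact, 'rV[R]_n -> R[i]^o}) :=
  fun b => cmpartial b F.

(* Uniform convergence of every derivative on every compact set. *)
HB.instance Definition _ :=
  Uniform.copy smoothfun (initial_topology smooth_jet).

Lemma cmpartialL (c : R[i]) (F G : smoothfun) b x :
  cmpartial b (c *: F + G) x = c *: cmpartial b F x + cmpartial b G x.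
Proof.
have /asboolP[rF iF] := sfunP F; have /asboolP[rG iG] := sfunP G.
rewrite /cmpartial ReL ImL.
rewrite (mpartial_lin b _ rF (smoothr_lin (- complex.Im c) iF rG)).
rewrite (mpartial_lin b _ iF (smoothr_lin (complex.Im c) rF iG)).
rewrite (mpartial_lin b _ iF rG) (mpartial_lin b _ rF iG).
by case: c => ? ? /=; apply/eqP; rewrite eq_complex /= mulNr !addrA !eqxx.
Qed.

End SmoothFunctions.

Section Whitney.
Variables (R : realType) (n : nat) (K : set 'rV[R]_n).

Definition restr (F : smoothfun R n) : mindex n -> K -> R[i]^o :=
  fun b x => cmpartial b F (\val x).

Definition whitney_pred : {pred mindex n -> K -> R[i]^o} :=
  fun f => `[< exists F, restr F = f >].

Lemma restrL (c : R[i]) (F G : smoothfun R n) :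
  restr (c *: F + G) = c *: restr F + restr G.
Proof. by apply/funext => b; apply/funext => x; rewrite /restr cmpartialL. Qed.

Lemma whitney_submod : submod_closed whitney_pred.
Proof.
split=> [|c _ _ /asboolP[F <-] /asboolP[G <-]]; apply/asboolP; last first.
  by exists (c *: F + G); exact: restrL.
exists 0; have := restrL (-1) 0 0.
by rewrite !scaleN1r oppr0 addr0 addNr.
Qed.

HB.instance Definition _ :=
  GRing.isSubmodClosed.Build R[i] (mindex n -> K -> R[i]^o) whitney_pred
    whitney_submod.

Record whitney := Whitney {
  wjet :> mindex n -> K -> R[i]^o;
  wjetP : wjet \in whitney_pred }.

HB.instance Definition _ := [isSub for wjet].
HB.instance Definition _ := [Choice of whitney by <:].
HB.instance Definition _ := [SubChoice_isSubLmodule of whitney by <:].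

Lemma restr_in (F : smoothfun R n) : restr F \in whitney_pred.
Proof. by apply/asboolP; exists F. Qed.

Definition rK (F : smoothfun R n) : whitney := Whitney (restr_in F).

(* The final topology of [rK], which is onto [whitney] by definition: this is
   the quotient topology. *)
Definition whitney_open (U : set whitney) : Prop := open (rK @^-1` U).

Lemma whitney_openT : whitney_open setT.
Proof. by rewrite /whitney_open preimage_setT; exact: openT. Qed.

Lemma whitney_openI : setI_closed whitney_open.
Proof. by move=> U V oU oV; exact: openI. Qed.

Lemma whitney_open_bigcup (I : Type) (U : I -> set whitney) :
  (forall i, whitney_open (U i)) -> whitney_open (\bigcup_i U i).
Proof. by move=> oU; apply: bigcup_open => i _; exact: oU. Qed.

HB.instance Definition _ := isOpenTopological.Build whitney
  whitney_openT whitney_openI whitney_open_bigcup.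

Definition jetD (j : 'I_n) (f : mindex n -> K -> R[i]^o) :
    mindex n -> K -> R[i]^o := fun b => f (mindexS b j).

Lemma jetD_whitney j (f : whitney) : jetD j f \in whitney_pred.
Proof.
have /asboolP[F Ff] := wjetP f; have /asboolP[rF iF] := sfunP F.
pose G : 'rV[R]_n -> R[i]^o := fun x =>
  partial j (fun y => complex.Re (F y)) x +i*
  partial j (fun y => complex.Im (F y)) x.
have sG : G \in @smooth_pred R n.
  apply/asboolP; split; first exact: (@smoothr_partials _ _ [:: j]).
  exact: (@smoothr_partials _ _ [:: j] _ iF).
apply/asboolP; exists (SmoothFun sG); apply/funext => b; apply/funext => x.
rewrite /jetD -Ff /restr /cmpartial.
by rewrite (mpartialS b j rF) (mpartialS b j iF).
Qed.

Definition wD (j : 'I_n) (f : whitney) : whitney := Whitney (jetD_whitney j f).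

End Whitney.

Section Normal.
Variables (R : realType) (n : nat).
Implicit Types (v : 'rV[R]_n) (K H : set 'rV[R]_n).

Definition dotr (x y : 'rV[R]_n) : R := \sum_i x 0 i * y 0 i.

Definition hyperplane v : set 'rV[R]_n := [set x | dotr x v = 0].

Definition normal_data v K H (phi psi : H -> R) : Prop :=
  [/\ compact H, H `<=` hyperplane v,
      forall x, phi x <= psi x &
      K = [set y | exists (x : H) (t : R),
                     phi x <= t <= psi x /\ y = t *: v + \val x]].

Definition vnormal v K : Prop :=
  exists (H : set 'rV[R]_n) (phi psi : H -> R), normal_data v K phi psi.

(* [x <= y] in [R[i]] means [Im x = Im y] and [Re x <= Re y], so that the
   inequalities force the values of [gamma] of order zero to be real. *)
Definition vnormal_smooth v K : Prop :=
  exists (H : set 'rV[R]_n) (phi psi : H -> R), normal_data v K phi psi /\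
  exists gamma : whitney H, forall x : H,
    (phi x)%:C <= gamma (mindex0 n) x <= (psi x)%:C.

End Normal.

(* Main.v *)
Require Import Defs.
From HB Require Import structures.
From mathcomp Require Import all_boot all_order all_algebra.
From mathcomp Require Import complex.
From mathcomp Require Import boolp classical_sets functions reals.
From mathcomp Require Import topology normedtype derive.
From mathcomp Require Import all_classical all_reals all_analysis.
From mathcomp Require Import ring lra.
Set Implicit Arguments.
Unset Strict Implicit.
Unset Printing Implicit Defensive.
Import Order.TTheory GRing.Theory Num.Theory.
Import numFieldNormedType.Exports.
Local Open Scope classical_set_scope.
Local Open Scope ring_scope.
Local Open Scope complex_scope.

(* Let Gam be a smooth function extending gamma.  Write foot x for the orthogonal
   projection of x to H_v, height x for the coordinate of x along v, and
   w x = height x - Gam (foot x).  The integral of exp(lambda (height x - s)) F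
   over the segment from Gam (foot x) to height x on the line x + R v solves the
   equation on R^n; rescaled to the unit interval it becomes
     L F x = w x * int_0^1 exp(lambda u w x) F(x - u w x v) du,
   whose domain of integration no longer depends on x.  The derivatives of L F at
   x are bounded by those of F on the segment, with constants that are locally
   uniform in x.  Hence L is continuous and, since for x in K the segment stays in
   K, it maps functions that are flat on K to functions that are flat on K, so
   that it descends to the quotient.  For the equation, (1 - u) d/du + w v.D kills
   x - u w v and maps u w to w, so an integration by parts in u turns the
   v-derivative of the integral into a boundary term at u = 0. *)

(** * Functions with continuous partial derivatives *)

(** The estimate says that the remainder is o(h), and a continuous linear map with such a remainder
    is the differential by uniqueness. *)
Lemma diff_of_estimate (R : numFieldType) (V W : normedModType R) (f : V -> W)
    (L : {linear V -> W}) (x : V) : continuous L ->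
  (forall eps : R, 0 < eps ->
     \forall h \near (0 : V), `|f (h + x) - f x - L h| <= eps * `|h|) ->
  differentiable f x /\ 'd f x = L :> (V -> W).
Proof.
move=> cL fL.
have key : f \o shift x = cst (f x) + L +o_ 0 id.
  apply/eqaddoP => eps eps0; apply: filterS (fL eps eps0) => h.
  by rewrite opprD addrA.
have dE := diff_unique cL key.
by split=> //; apply/diff_locallyP; rewrite dE; split.
Qed.

Section Differentiability.
Variables (R : realType) (n : nat).
Implicit Types (f g : 'rV[R]_n -> R) (x v : 'rV[R]_n).

(** For negative h the mean value theorem is applied to the segment run from x + h e back to x,
    which turns its parameter c into h + c. *)
Lemma mvt_line_signed f x (e : 'rV[R]_n) (h : R) :
  (forall y, derivable f y e) ->
  exists2 c, `|c| <= `|h| & f (x + h *: e) - f x = h * 'D_e f (x + c *: e).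
Proof.
move=> df; have [h0|h0|->] := ltrgtP h 0; last first.
- by exists 0; rewrite // scale0r addr0 subrr mul0r.
- have [c /andP[c0 ch] E] := mvt_line x h0 df.
  by exists c; rewrite // !gtr0_norm // ltW.
have Nh0 : 0 < - h by rewrite oppr_gt0.
have [c /andP[c0 ch] E] := mvt_line (x + h *: e) Nh0 df.
exists (h + c); last first.
  move: E; rewrite scaleNr addrK -addrA -scalerDl => E.
  by rewrite -opprB E mulNr opprK.
rewrite (ltr0_norm h0) ler_norml opprK lerDl (ltW c0) /=.
rewrite (le_trans (y := 0)) ?oppr_ge0 ?ltW //.
by rewrite -ltrBrDl sub0r.
Qed.

Lemma mx_norm_entry_le p q (A B : 'M[R]_(p, q)) :
  (forall i j, `|A i j| <= `|B i j|) -> `|A| <= `|B|.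
Proof.
move=> AB; rewrite /Num.Def.normr/= !mx_normrE.
apply/bigmax_leP; split=> [|[i j] _ /=].
  by rewrite -mx_normrE; exact: (normr_ge0 B).
apply: le_trans (AB i j) _.
exact: (le_bigmax_cond _ (fun ij : 'I_p * 'I_q => `|B ij.1 ij.2|) (j := (i, j))).
Qed.

Lemma entry_le_mx_norm p q (B : 'M[R]_(p, q)) i j : `|B i j| <= `|B|.
Proof.
rewrite [leRHS]/Num.Def.normr/= mx_normrE.
exact: (le_bigmax_cond _ (fun ij : 'I_p * 'I_q => `|B ij.1 ij.2|) (j := (i, j))).
Qed.

(** The increment of f telescopes along a path parallel to the axes. On each edge the mean value
    theorem yields h_k times a partial derivative at a point within |h| of x, where continuity
    brings it close to its value at x. *)
Lemma continuous_partials_diff f x :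
  (forall y i, derivable f y (ebase R i)) -> (forall i, continuous (partial i f)) ->
  differentiable f x /\ forall v, 'd f x v = \sum_i v 0 i * partial i f x.
Proof.
move=> df cf.
pose L v := \sum_i v 0 i * partial i f x.
have linL : linear L.
  move=> a u v; rewrite /L scaler_sumr -big_split /=; apply: eq_bigr => i _.
  by rewrite !mxE mulrDl -mulrA.
pose LL := GRing.isLinear.Build _ _ _ _ _ linL.
pose LM : {linear 'rV[R]_n -> R} := HB.pack L LL.
have cL : continuous LM.
  apply: continuous_big => [|i _ y]; first exact: add_continuous.
  exact: (cvgMr_tmp (b := partial i f x) (@coord_continuous R 1 n 0 i y)).
have [|dfx dE] := @diff_of_estimate _ _ _ f LM x cL; last by split=> // v; rewrite dE.
move=> _/posnumP[eps].
(* Each of the n edges will contribute at most |h| e, so the total is at most eps |h|; n + 1 keeps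
   the denominator positive when n = 0. *)
pose e := eps%:num / n.+1%:R.
have e0 : 0 < e by rewrite divr_gt0.
have Ni (i : 'I_n) : \forall y \near x, `|partial i f x - partial i f y| < e.
  by have /cvgrPdist_lt := cf i x; exact.
have [d /= d0 dP] := (nbhs_normP _ _).1 (filter_forall (nbhs_filter x) Ni).
have : \forall h \near (0 : 'rV[R]_n), `|h| < d by exact: nbhs0_lt.
apply: filterS => h hd.
(* [hk] runs from 0 to [h] along the coordinate axes. *)
pose hk k : 'rV[R]_n := \row_j (if (j < k)%N then h 0 j else 0).
have hk0 : hk 0%N = 0 by apply/rowP => j; rewrite !mxE.
have hkn : hk n = h by apply/rowP => j; rewrite !mxE ltn_ord.
have hkS (k : 'I_n) : hk k.+1 = hk k + h 0 k *: ebase R k.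
  apply/rowP => j; rewrite !mxE ltnS leq_eqVlt /=.
  have [/val_inj ->|jk] := eqVneq (val j) (val k).
    by rewrite ltnn /= eqxx mulr1 add0r.
  rewrite (negbTE (_ : j != k)) ?mulr0 ?addr0 //.
have step (k : 'I_n) : `|f (x + hk k.+1) - f (x + hk k) - h 0 k * partial k f x|
    <= `|h| * e.
  have [c ch E] := mvt_line_signed (x + hk k) (h 0 k) (fun y => df y k).
  rewrite hkS addrA E -mulrBr normrM.
  apply: ler_pM => //; first exact: entry_le_mx_norm.
  rewrite distrC ltW //; apply: dP => /=.
  rewrite -addrA opprD addrA subrr sub0r normrN.
  (* The displacement hk + c e_k is dominated entrywise by h, and the norm is the maximum norm. *)
  apply: le_lt_trans hd; apply: mx_norm_entry_le => i j.
  rewrite !mxE ord1 /=.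
  case: (ltngtP (val j) (val k)) => jk.
  - rewrite (negbTE (_ : j != k)) ?mulr0 ?addr0 //.
    by apply: contraTneq jk => ->; rewrite ltnn.
  - rewrite (negbTE (_ : j != k)) ?mulr0 ?addr0 ?normr0 //.
    by apply: contraTneq jk => ->; rewrite ltnn.
  - by rewrite (val_inj jk) eqxx mulr1 add0r.
have -> : f (h + x) = f x + \sum_(k < n) (f (x + hk k.+1) - f (x + hk k)).
  rewrite -(big_mkord xpredT (fun k => f (x + hk k.+1) - f (x + hk k))).
  by rewrite telescope_sumr // hk0 hkn addr0 addrCA subrr addr0 addrC.
rewrite (addrAC (f x)) subrr add0r /LM /= /L -sumrB.
apply: le_trans (ler_norm_sum _ _ _) _.
apply: le_trans (ler_sum _ (fun k _ => step k)) _.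
rewrite sumr_const card_ord -mulr_natl mulrCA mulrC.
apply: ler_wpM2r => //; rewrite mulrC /e -mulrA ger_pMr // ler_pdivrMl //.
by rewrite mulr1 ler_nat.
Qed.

End Differentiability.

(** M is only derivable along e, so it is first restricted to the line through x, where it is a
    differentiable function of one variable; the chain rule for differentials then applies. *)
Lemma is_derive_comp (R : numFieldType) (U V W : normedModType R)
    (g : V -> W) (M : U -> V) x e :
  derivable M x e -> differentiable g (M x) ->
  is_derive x e (fun y => g (M y)) ('d g (M x) ('D_e M x)).
Proof.
move=> dM dg.
have dc : differentiable (fun h : R => M (h *: e + x)) (0 : R).
  by apply/derivable1_diffP; exact: (derivable1P _ _ _).1.
have M0 : M ((0 : R) *: e + x) = M x by rewrite scale0r add0r.
have dg' : differentiable g (M ((0 : R) *: e + x)) by rewrite M0.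
have dgc := differentiable_comp dc dg'.
have D0 (Z : normedModType R) (f : U -> Z) :
    'D_e f x = 'D_1 (fun h : R => f (h *: e + x)) 0.
  have E : (fun h : R => h^-1 *: (f (h *: e + x) - f x)) = (fun h : R =>
      h^-1 *: (f ((h *: (1 : R) + 0) *: e + x) - f ((0 : R) *: e + x))).
    by apply/funext => h; rewrite addr0 scale0r add0r [_%:A]mulr1.
  by rewrite /derive /= E.
split; first by apply/derivable1P; exact: diff_derivable.
by rewrite D0 (deriveE _ dgc) (diff_comp dc dg') /= M0 D0 (deriveE _ dc).
Qed.

Lemma continuous_row (R : realFieldType) (T : topologicalType) n
    (M : T -> 'rV[R]_n) :
  (forall i, continuous (fun x => M x 0 i)) -> continuous M.
Proof.
move=> cM x; apply/cvgrPdist_le => e e0.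
have Ni (i : 'I_n) : \forall y \near x, `|M x 0 i - M y 0 i| <= e.
  by have /cvgrPdist_le := cM i x; exact.
apply: filterS (filter_forall (nbhs_filter x) Ni) => y My.
rewrite [leLHS]/Num.Def.normr/= mx_normrE; apply: (bigmax_le _ (ltW e0)) => -[i j] _ /=.
by rewrite ord1 !mxE; exact: My.
Qed.

(** * The classes C^k and their closure properties *)

Section SmoothClass.
Variable R : realType.

(** C^k by recursion on the order. The product and chain rules turn one derivative into a sum of
    products, which suits an induction on k better than the words of derivatives in [smoothr]. *)
Fixpoint Cr n k : ('rV[R]_n -> R) -> Prop := fun f =>
  continuous f /\
  if k is k'.+1 then
    (forall x j, derivable f x (ebase R j)) /\ forall j, @Cr n k' (partial j f)
  else True.

Lemma CrS n k (f : 'rV[R]_n -> R) : Cr k.+1 f <->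
  [/\ continuous f, forall x j, derivable f x (ebase R j) &
      forall j, Cr k (partial j f)].
Proof. by split=> [[? []]|[]]. Qed.

Lemma Cr_continuous n k (f : 'rV[R]_n -> R) : Cr k f -> continuous f.
Proof. by case: k => [|k] []. Qed.

Lemma CrW n k (f : 'rV[R]_n -> R) : Cr k.+1 f -> Cr k f.
Proof.
elim: k f => [|k IH] f /CrS[cf df pf]; first by split.
by apply/CrS; split=> // j; exact: IH.
Qed.

Lemma smoothrP n (f : 'rV[R]_n -> R) : smoothr f <-> forall k, Cr k f.
Proof.
split=> [sf k|Cf].
  elim: k f sf => [|k IH] f sf; have [cf df] := sf [::]; first by [].
  apply/CrS; split=> // j.
  by apply: IH; exact: (@smoothr_partials _ _ [:: j]).
have Cs s k : Cr k (partials s f).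
  by elim: s k => [|j s IH] k //=; have /CrS[_ _] := IH k.+1; exact.
by move=> s; have /CrS[cs ds _] := Cs s 1%N; split=> // j x; exact: ds.
Qed.

Lemma Cr_diff n k (f : 'rV[R]_n -> R) x : Cr k.+1 f ->
  differentiable f x /\ forall v, 'd f x v = \sum_i v 0 i * partial i f x.
Proof.
move=> /CrS[cf df pf]; apply: continuous_partials_diff => // i.
exact: Cr_continuous (pf i).
Qed.

Lemma Cr_cst n k (a : R) : Cr k (fun _ : 'rV[R]_n => a).
Proof.
elim: k a => [|k IH] a; first by split=> //; exact: cst_continuous.
apply/CrS; split=> [|x j|j]; first exact: cst_continuous.
  exact: derivable_cst.
rewrite (_ : partial j _ = fun=> 0); first exact: IH.
by apply/funext => x; exact: derive_cst.
Qed.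

Lemma partialD n (f g : 'rV[R]_n -> R) j :
  (forall x, derivable f x (ebase R j)) -> (forall x, derivable g x (ebase R j)) ->
  partial j (fun x => f x + g x) = (fun x => partial j f x + partial j g x).
Proof. by move=> df dg; apply/funext => x; exact: deriveD. Qed.

Lemma partialM n (f g : 'rV[R]_n -> R) j :
  (forall x, derivable f x (ebase R j)) -> (forall x, derivable g x (ebase R j)) ->
  partial j (fun x => f x * g x) = (fun x => f x * partial j g x + g x * partial j f x).
Proof. by move=> df dg; apply/funext => x; exact: deriveM. Qed.

Lemma CrD n k (f g : 'rV[R]_n -> R) : Cr k f -> Cr k g ->
  Cr k (fun x => f x + g x).
Proof.
elim: k f g => [|k IH] f g.
  by move=> [cf _] [cg _]; split=> // x; apply: continuousD; [exact: cf|exact: cg].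
move=> /CrS[cf df pf] /CrS[cg dg pg]; apply/CrS; split=> [|x j|j].
  by move=> x; apply: continuousD; [exact: cf|exact: cg].
  exact: derivableD.
by rewrite partialD => [|x|x] //; exact: IH.
Qed.

Lemma CrM n k (f g : 'rV[R]_n -> R) : Cr k f -> Cr k g ->
  Cr k (fun x => f x * g x).
Proof.
elim: k f g => [|k IH] f g.
  by move=> [cf _] [cg _]; split=> // x; apply: continuousM; [exact: cf|exact: cg].
move=> Cf Cg; have /CrS[cf df pf] := Cf; have /CrS[cg dg pg] := Cg.
apply/CrS; split=> [|x j|j].
  by move=> x; apply: continuousM; [exact: cf|exact: cg].
  exact: derivableM.
rewrite partialM => [|x|x] //; apply: CrD; apply: IH => //; exact: CrW.
Qed.

Lemma Cr_sum n k (I : Type) (s : seq I) (F : I -> 'rV[R]_n -> R) :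
  (forall i, Cr k (F i)) -> Cr k (fun x => \sum_(i <- s) F i x).
Proof.
move=> CF; elim: s => [|i s IH].
  rewrite (_ : (fun _ => _) = fun=> 0); first exact: Cr_cst.
  by apply/funext => x; rewrite big_nil.
rewrite (_ : (fun _ => _) = fun x => F i x + \sum_(j <- s) F j x); first exact: CrD.
by apply/funext => x; rewrite big_cons.
Qed.

Lemma derivable_coord n (i : 'I_n) (x v : 'rV[R]_n) :
  derivable (fun x : 'rV[R]_n => x 0 i) x v.
Proof. by have /derivable_mxP := @derivable_id _ _ x v; exact. Qed.

Lemma derive_coord n (i : 'I_n) (x v : 'rV[R]_n) :
  'D_v (fun x : 'rV[R]_n => x 0 i) x = v 0 i.
Proof.
by rewrite -[in RHS](derive_id x v) (derive_mx (@derivable_id _ _ x v)) mxE.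
Qed.

Lemma partial_coord n (i j : 'I_n) :
  partial j (fun x : 'rV[R]_n => x 0 i) = fun=> (i == j)%:R.
Proof.
by apply/funext => x; rewrite /partial derive_coord !mxE eqxx.
Qed.

Lemma Cr_coord n k (i : 'I_n) : Cr k (fun x : 'rV[R]_n => x 0 i).
Proof.
case: k => [|k]; first by split=> //; exact: coord_continuous.
apply/CrS; split=> [|x j|j]; first exact: coord_continuous.
  exact: derivable_coord.
by rewrite partial_coord; exact: Cr_cst.
Qed.

Lemma is_derive_comp_row m n (g : 'rV[R]_n -> R) (M : 'rV[R]_m -> 'rV[R]_n) x v :
  (forall i, derivable (fun x => M x 0 i) x v) -> Cr 1 g ->
  is_derive x v (fun y => g (M y))
    (\sum_i partial i g (M x) * 'D_v (fun x => M x 0 i) x).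
Proof.
move=> dMi Cg.
have dM : derivable M x v by apply/derivable_mxP => i j; rewrite ord1; exact: dMi.
have [dg dgE] := Cr_diff (M x) Cg.
suff -> : \sum_i partial i g (M x) * 'D_v (fun x => M x 0 i) x =
    'd g (M x) ('D_v M x) by exact: is_derive_comp.
by rewrite dgE derive_mx //; apply: eq_bigr => i _; rewrite mxE mulrC.
Qed.

Lemma partial_comp m n (g : 'rV[R]_n -> R) (M : 'rV[R]_m -> 'rV[R]_n) j :
  (forall i x, derivable (fun x => M x 0 i) x (ebase R j)) -> Cr 1 g ->
  partial j (fun x => g (M x)) =
    fun x => \sum_i partial i g (M x) * partial j (fun x => M x 0 i) x.
Proof.
move=> dM Cg; apply/funext => x.
by have [_] := is_derive_comp_row (fun i => dM i x) Cg.
Qed.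

(** A partial derivative of the composition is a sum of products of some D_i g composed with M and a
    derivative of a component of M. All factors have order k, so induction on k closes. *)
Lemma Cr_comp m n k (g : 'rV[R]_n -> R) (M : 'rV[R]_m -> 'rV[R]_n) :
  Cr k g -> (forall i, Cr k (fun x => M x 0 i)) -> Cr k (fun x => g (M x)).
Proof.
elim: k g => [|k IH] g Cg CM.
  split=> // x; apply: continuous_comp; last by have [cg _] := Cg; exact: cg.
  by apply: continuous_row => i; have [] := CM i.
have C1 (h : 'rV[R]_n -> R) : Cr k.+1 h -> Cr 1 h.
  move=> /CrS[ch dh ph]; apply/CrS; split=> // j.
  by split=> //; exact: Cr_continuous (ph j).
have /CrS[cg dg pg] := Cg.
have dM i x j : derivable (fun x => M x 0 i) x (ebase R j).
  by have /CrS[_ + _] := CM i; exact.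
apply/CrS; split=> [|x j|j].
  move=> x; apply: continuous_comp; last exact: cg.
  by apply: continuous_row => i; have [] := CM i.
  by have [] := is_derive_comp_row (fun i => dM i x j) (C1 _ Cg).
rewrite partial_comp //; last exact: C1.
apply: Cr_sum => i; apply: CrM; last by have /CrS[_ _] := CM i; exact.
by apply: IH => // i'; exact: CrW.
Qed.

(** The induction meets the derivative of phi in place of phi, hence the statement for a whole
    family [P] closed under differentiation. *)
Lemma Cr_univariate (P : (R -> R) -> Prop) :
  (forall phi, P phi -> exists2 phi', P phi' & forall t : R, is_derive t 1 phi (phi' t)) ->
  forall n k (f : 'rV[R]_n -> R) phi, P phi -> Cr k f -> Cr k (fun x => phi (f x)).
Proof.
move=> HP n k f phi Pphi Cf.
have cP psi : P psi -> continuous psi.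
  move=> /HP[psi' _ D] t; apply: differentiable_continuous.
  by apply/derivable1_diffP; have [] := D t.
elim: k phi Pphi Cf => [|k IH] phi Pphi Cf.
  split=> // x; apply: continuous_comp; last exact: cP.
  by have [cf _] := Cf; exact: cf.
have /CrS[cf df pf] := Cf; have [phi' Pphi' D] := HP _ Pphi.
have DC x j : is_derive x (ebase R j) (fun x => phi (f x)) (phi' (f x) * partial j f x).
  have dphi : differentiable phi (f x) by apply/derivable1_diffP; have [] := D (f x).
  have := is_derive_comp (df x j) dphi.
  rewrite diff1E // derive1E.
  have [_ ->] := D (f x).
  by rewrite /= -[_ *: _]/(_ * _) mulrC.
apply/CrS; split=> [|x j|j].
- by move=> x; apply: continuous_comp; [exact: cf|exact: cP].
- by have [] := DC x j.
rewrite (_ : partial j _ = fun x => phi' (f x) * partial j f x).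
  by apply: CrM => //; apply: IH => //; exact: CrW.
by apply/funext => x; have [] := DC x j.
Qed.

End SmoothClass.

(** * Estimates on jets *)

Section JetBounds.
Variable R : realType.

(* For e = 0 this is flatness of order k on A, so that one family of estimates
   gives both the continuity of the operator and its descent to the quotient. *)
Fixpoint jet_le n k (A : set 'rV[R]_n) (e : R) : ('rV[R]_n -> R) -> Prop := fun f =>
  (forall x, A x -> `|f x| <= e) /\
  if k is k'.+1 then forall j, @jet_le n k' A e (partial j f) else True.

Lemma jet_leS n k (A : set 'rV[R]_n) e f : jet_le k.+1 A e f <->
  (forall x, A x -> `|f x| <= e) /\ forall j, jet_le k A e (partial j f).
Proof. by []. Qed.

Lemma jet_leW n k (A : set 'rV[R]_n) e f : jet_le k.+1 A e f -> jet_le k A e f.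
Proof.
elim: k f => [|k IH] f /jet_leS[bf pf]; first by split.
by apply/jet_leS; split=> // j; exact: IH.
Qed.

Lemma jet_le_sub n k (A A' : set 'rV[R]_n) e e' f :
  A' `<=` A -> e <= e' -> jet_le k A e f -> jet_le k A' e' f.
Proof.
move=> AA ee; elim: k f => [|k IH] f.
  by move=> [bf _]; split=> // x /AA/bf/le_trans; exact.
move=> /jet_leS[bf pf]; apply/jet_leS; split=> [x /AA/bf/le_trans|j]; first exact.
exact: IH.
Qed.

Lemma jet_leP n k (A : set 'rV[R]_n) e f : jet_le k A e f <->
  forall s, (size s <= k)%N -> forall x, A x -> `|partials s f x| <= e.
Proof.
elim: k f => [|k IH] f; split.
- by move=> [bf _] [|//] _ x Ax; exact: bf.
- by move=> bf; split=> // x Ax; exact: (bf [::]).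
(* [jet_le] peels off the derivative applied to f first, which is the last letter of the word. *)
- move=> /jet_leS[bf pf] s; case/lastP: s => [_ x Ax|s j]; first exact: bf.
  by rewrite size_rcons ltnS /partials foldr_rcons => /((IH _).1 (pf j)).
- move=> bf; apply/jet_leS; split=> [x Ax|j]; first exact: (bf [::]).
  apply/IH => s sk x Ax; have := bf (rcons s j); rewrite size_rcons ltnS => /(_ sk x Ax).
  by rewrite /partials foldr_rcons.
Qed.

Lemma smoothr_partial n (f : 'rV[R]_n -> R) j : smoothr f -> smoothr (partial j f).
Proof. exact: (@smoothr_partials _ _ [:: j]). Qed.

Lemma smoothr_derivable n (f : 'rV[R]_n -> R) : smoothr f ->
  forall j x, derivable f x (ebase R j).
Proof. by move=> /(_ [::])[_]; exact. Qed.
#[global] Arguments smoothr_derivable [n f] _ _ _.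

Lemma smoothr_continuous n (f : 'rV[R]_n -> R) : smoothr f -> continuous f.
Proof. by move=> /(_ [::])[]. Qed.

Lemma smoothrD n (f g : 'rV[R]_n -> R) : smoothr f -> smoothr g ->
  smoothr (fun x => f x + g x).
Proof. by move=> /smoothrP sf /smoothrP sg; apply/smoothrP => k; exact: CrD. Qed.

Lemma smoothrM n (f g : 'rV[R]_n -> R) : smoothr f -> smoothr g ->
  smoothr (fun x => f x * g x).
Proof. by move=> /smoothrP sf /smoothrP sg; apply/smoothrP => k; exact: CrM. Qed.

Lemma smoothr_cst n (a : R) : smoothr (fun _ : 'rV[R]_n => a).
Proof. by apply/smoothrP => k; exact: Cr_cst. Qed.

Lemma smoothr_coord n (i : 'I_n) : smoothr (fun x : 'rV[R]_n => x 0 i).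
Proof. by apply/smoothrP => k; exact: Cr_coord. Qed.

Lemma smoothrN n (f : 'rV[R]_n -> R) : smoothr f -> smoothr (fun x => - f x).
Proof.
move=> sf; under eq_fun do rewrite -mulN1r.
exact: smoothrM (smoothr_cst _) sf.
Qed.

Lemma smoothr_sum n (I : Type) (s : seq I) (F : I -> 'rV[R]_n -> R) :
  (forall i, smoothr (F i)) -> smoothr (fun x => \sum_(i <- s) F i x).
Proof. by move=> sF; apply/smoothrP => k; apply: Cr_sum => i; exact: (smoothrP _).1. Qed.

Lemma smoothr_comp m n (g : 'rV[R]_n -> R) (M : 'rV[R]_m -> 'rV[R]_n) :
  smoothr g -> (forall i, smoothr (fun x => M x 0 i)) -> smoothr (fun x => g (M x)).
Proof.
move=> /smoothrP sg sM; apply/smoothrP => k.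
by apply: Cr_comp => // i; exact: (smoothrP _).1.
Qed.

Lemma jet_leD n k (A : set 'rV[R]_n) e e' f g : smoothr f -> smoothr g ->
  jet_le k A e f -> jet_le k A e' g -> jet_le k A (e + e') (fun x => f x + g x).
Proof.
elim: k f g => [|k IH] f g sf sg.
  move=> [bf _] [bg _]; split=> // x Ax.
  by rewrite (le_trans (ler_normD _ _)) // lerD ?bf ?bg.
move=> /jet_leS[bf pf] /jet_leS[bg pg]; apply/jet_leS; split=> [x Ax|j].
  by rewrite (le_trans (ler_normD _ _)) // lerD ?bf ?bg.
rewrite (partialD (smoothr_derivable sf j) (smoothr_derivable sg j)).
exact: IH (smoothr_partial j sf) (smoothr_partial j sg) (pf j) (pg j).
Qed.

(** The Leibniz rule doubles the number of products with each derivative, whence the factor 2^k. *)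
Lemma jet_leM n k (A : set 'rV[R]_n) a e f g : smoothr f -> smoothr g -> 0 <= a -> 0 <= e ->
  jet_le k A a f -> jet_le k A e g -> jet_le k A (2 ^+ k * (a * e)) (fun x => f x * g x).
Proof.
move=> + + a0 e0; have ae0 : 0 <= a * e by exact: mulr_ge0.
elim: k f g => [|k IH] f g sf sg.
  move=> [bf _] [bg _]; split=> // x Ax.
  by rewrite expr0 mul1r normrM ler_pM ?bf ?bg.
move=> Bf Bg; have /jet_leS[bf pf] := Bf; have /jet_leS[bg pg] := Bg.
apply/jet_leS; split=> [x Ax|j].
  rewrite normrM (le_trans (ler_pM _ _ (bf x Ax) (bg x Ax))) //.
  by rewrite ler_peMl // exprn_ege1 // ler1n.
rewrite (partialM (smoothr_derivable sf j) (smoothr_derivable sg j)).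
have sf' := smoothr_partial j sf; have sg' := smoothr_partial j sg.
rewrite exprS -mulrA mulr_natl mulr2n.
apply: jet_leD (smoothrM sf sg') (smoothrM sg sf') (IH _ _ sf sg' (jet_leW Bf) (pg j)) _.
rewrite (_ : (fun _ => _) = (fun x => partial j f x * g x)).
  exact: IH _ _ sf' sg (pf j) (jet_leW Bg).
by apply/funext => x; rewrite mulrC.
Qed.

Lemma jet_le_cst0 n k (A : set 'rV[R]_n) : jet_le k A 0 (fun=> 0).
Proof. by apply/jet_leP => s _ x Ax; rewrite partials_cst0 normr0. Qed.

Lemma jet_le_sum n k (A : set 'rV[R]_n) (I : Type) (s : seq I) (F : I -> 'rV[R]_n -> R) e :
  (forall i, smoothr (F i)) -> (forall i, jet_le k A e (F i)) ->
  jet_le k A ((size s)%:R * e) (fun x => \sum_(i <- s) F i x).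
Proof.
move=> sF bF; elim: s => [|i s IH] /=.
  rewrite mul0r (_ : (fun _ => _) = fun=> 0); first exact: jet_le_cst0.
  by apply/funext => x; rewrite big_nil.
rewrite (_ : (fun _ => _) = fun x => F i x + \sum_(j <- s) F j x).
  by rewrite -natr1 mulrDl mul1r addrC; apply: jet_leD => //; exact: smoothr_sum.
by apply/funext => x; rewrite big_cons.
Qed.

Lemma finite_common_bound (I : finType) (P : I -> R -> Prop) :
  (forall i a b, a <= b -> P i a -> P i b) ->
  (forall i, exists2 B, 0 <= B & P i B) -> exists2 B, 0 <= B & forall i, P i B.
Proof.
move=> PW PB; pose b i := s2val (cid2 (PB i)).
have b0 i : 0 <= b i by rewrite /b; case: cid2.
have Pb i : P i (b i) by rewrite /b; case: cid2.
exists (\sum_i b i); first exact: sumr_ge0.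
by move=> i; apply: PW (Pb i); rewrite (bigD1 i) //= lerDl sumr_ge0.
Qed.

Lemma continuous_compact_bound n (A : set 'rV[R]_n) (f : 'rV[R]_n -> R) :
  compact A -> continuous f -> exists2 B : R, 0 <= B & forall x, A x -> `|f x| <= B.
Proof.
move=> cA /continuous_subspaceT cf.
have [M [_ MA]] := compact_bounded (continuous_compact (cf A) cA).
exists (`|M| + 1); first by rewrite addr_ge0.
by move=> x Ax; apply: MA; [rewrite ltr_pwDr // ler_norm|exists x].
Qed.

Lemma jet_le_compact n k (A : set 'rV[R]_n) f : compact A -> smoothr f ->
  exists2 B, 0 <= B & jet_le k A B f.
Proof.
move=> cA; elim: k f => [|k IH] f sf.
  have [B B0 bf] := continuous_compact_bound cA (smoothr_continuous sf).
  by exists B.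
have [B0 B00 bf] := continuous_compact_bound cA (smoothr_continuous sf).
have [B1 B10 pf] : exists2 B, 0 <= B & forall j, jet_le k A B (partial j f).
  apply: (@finite_common_bound _ (fun j B => jet_le k A B (partial j f))) => [j a b ab|j].
    exact: jet_le_sub.
  exact: IH (smoothr_partial j sf).
exists (B0 + B1); first exact: addr_ge0.
apply/jet_leS; split=> [x Ax|j]; first by rewrite (le_trans (bf x Ax)) // lerDl.
by apply: jet_le_sub (pf j) => //; rewrite lerDr.
Qed.

(** By the chain rule and induction on k, with the derivatives of M bounded on the compact set A.
    The constant is chosen before g and the bound is linear in e, so flatness of g on the image of A
    passes to the composition. *)
Lemma jet_le_comp m n k (A : set 'rV[R]_m) (M : 'rV[R]_m -> 'rV[R]_n) :
  compact A -> (forall i, smoothr (fun x => M x 0 i)) ->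
  exists2 B, 0 <= B & forall g e, smoothr g -> 0 <= e -> jet_le k (M @` A) e g ->
    jet_le k A (B * e) (fun x => g (M x)).
Proof.
move=> cA sM; elim: k => [|k [B B0 IH]].
  exists 1 => // g e sg e0 [bg _]; rewrite mul1r; split=> // x Ax.
  by apply: bg; exists x.
have [C C0 bM] : exists2 C, 0 <= C &
    forall ij : 'I_n * 'I_m, jet_le k A C (partial ij.2 (fun x => M x 0 ij.1)).
  apply: (@finite_common_bound _
    (fun ij C => jet_le k A C (partial ij.2 (fun x => M x 0 ij.1)))).
    by move=> ij a b ab; exact: jet_le_sub.
  by move=> ij; exact: (jet_le_compact k cA (smoothr_partial ij.2 (sM ij.1))).
(* The chain rule gives one product per coordinate, each estimated by [jet_leM] from the induction
   hypothesis and the bound [C] on the derivatives of M. *)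
pose B' := (size (index_enum 'I_n))%:R * (2 ^+ k * (B * C)).
have B'0 : 0 <= B' by rewrite !mulr_ge0.
(* The summand 1 accounts for the values of g, the summand [B'] for the derivatives. *)
exists (1 + B'); first by rewrite addr_ge0.
move=> g e sg e0 /jet_leS[bg pg]; apply/jet_leS; split=> [x Ax|j].
  have gx : `|g (M x)| <= e by apply: bg; exists x.
  by rewrite mulrDl mul1r (le_trans gx) // lerDl mulr_ge0.
rewrite partial_comp; last 2 first.
- by move=> i; exact: (smoothr_derivable (sM i) j).
- exact: (smoothrP _).1.
apply: (@jet_le_sub _ _ A _ (B' * e)) => //; first by rewrite ler_wpM2r // lerDr.
rewrite /B' -mulrA; apply: jet_le_sum => i.
  exact: smoothrM (smoothr_comp (smoothr_partial i sg) sM) (smoothr_partial j (sM i)).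
rewrite -mulrA (mulrAC B); apply: jet_leM; last exact: (bM (i, j)).
- exact: smoothr_comp (smoothr_partial i sg) sM.
- exact: smoothr_partial j (sM i).
- exact: mulr_ge0.
- exact: C0.
- exact: IH (smoothr_partial i sg) e0 (pg i).
Qed.

End JetBounds.
Arguments smoothr_coord {R n} i _.

(** * Integrals with a parameter *)

Section UnitIntegral.
Variable R : realType.
Implicit Types f g : R -> R.

Definition int01 f : R := \int[lebesgue_measure]_(t in `[0, 1]) f t.

Lemma integrable01 f : continuous f ->
  lebesgue_measure.-integrable `[0 : R, 1] (EFin \o f).
Proof.
move=> cf; apply: continuous_compact_integrable; first exact: segment_compact.
exact: continuous_subspaceT.
Qed.

Lemma int01D f g : continuous f -> continuous g ->
  int01 (fun t => f t + g t) = int01 f + int01 g.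
Proof. by move=> cf cg; rewrite /int01 RintegralD //; exact: integrable01. Qed.

Lemma int01B f g : continuous f -> continuous g ->
  int01 (fun t => f t - g t) = int01 f - int01 g.
Proof. by move=> cf cg; rewrite /int01 RintegralB //; exact: integrable01. Qed.

Lemma int01Z a f : continuous f -> int01 (fun t => a * f t) = a * int01 f.
Proof. by move=> cf; rewrite /int01 RintegralZl //; exact: integrable01. Qed.

Lemma int01_bound f e : continuous f ->
  (forall t, 0 <= t <= 1 -> `|f t| <= e) -> `|int01 f| <= e.
Proof.
move=> cf fe.
have If := integrable01 cf.
have Inf : lebesgue_measure.-integrable `[0 : R, 1] (EFin \o (fun t => `|f t|)).
  by apply: integrable01 => t; apply: cvg_norm; exact: cf.
have Ie : lebesgue_measure.-integrable `[0 : R, 1] (EFin \o (fun=> e)).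
  by apply: integrable01; exact: cst_continuous.
apply: le_trans (le_normr_Rintegral _ If) _ => //.
have fe' t : `[0 : R, 1]%classic t -> `|f t| <= e by rewrite /= in_itv /=; exact: fe.
apply: le_trans (le_Rintegral _ Inf Ie fe') _ => //.
rewrite Rintegral_cst //= lebesgue_measure_itv /= lte_fin ltr01.
by rewrite oppr0 adde0 /= mulr1.
Qed.

Lemma int01_FTC f g : continuous g -> (forall t : R, is_derive t 1 f (g t)) ->
  int01 g = f 1 - f 0.
Proof.
move=> cg df.
have cf : continuous f.
  move=> t; apply: differentiable_continuous; apply/derivable1_diffP.
  by have [] := df t.
rewrite /int01 /Rintegral (@continuous_FTC2 _ _ f) //.
- exact: continuous_subspaceT.
- split; first by move=> t _; have [] := df t.
  + by apply: cvg_at_right_filter; exact: cf.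
  + by apply: cvg_at_left_filter; exact: cf.
- by move=> t _; rewrite derive1E; have [] := df t.
Qed.

End UnitIntegral.

Section ParamIntegral.
Variables (R : realType) (n : nat).
Implicit Types (a : 'rV[R]_(1 + n) -> R) (x : 'rV[R]_n).

(* R x R^n is encoded as R^(1 + n), the coordinate of index 0 being the
   integration variable. *)
Definition tx (t : R) x : 'rV[R]_(1 + n) := row_mx (const_mx t) x.

Lemma tx_l t x i : tx t x 0 (lshift n i) = t.
Proof. by rewrite /tx row_mxEl mxE. Qed.

Lemma tx_r t x i : tx t x 0 (rshift 1 i) = x 0 i.
Proof. by rewrite /tx row_mxEr. Qed.

Lemma tx_addr t x h i :
  tx t (x + h *: ebase R i) = tx t x + h *: ebase R (rshift 1 i).
Proof.
apply/rowP => j; rewrite !mxE; case: splitP => k jk; rewrite ?mxE eqxx /=.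
  rewrite (_ : j == _ = false) ?mulr0 ?addr0 //.
  by apply/negbTE/eqP => jE; move: jk; rewrite jE (ord1 k).
rewrite (_ : (j == _) = (k == i)) //; apply/eqP/eqP => [jE|<-]; apply/val_inj.
  by move: jk; rewrite jE /= !add1n => -[].
exact: jk.
Qed.

Lemma tx_addl t x h :
  tx (h + t) x = h *: ebase R (lshift n ord0) + tx t x.
Proof.
apply/rowP => j; rewrite !mxE; case: splitP => k jk; rewrite ?mxE eqxx /=.
  rewrite (_ : j == _ = true) ?mulr1 //.
  by apply/eqP/val_inj; rewrite /= jk (ord1 k).
rewrite (_ : j == _ = false) ?mulr0 ?add0r //.
by apply/negbTE; apply/eqP => jE; move: jk; rewrite jE.
Qed.

Lemma continuous_tx : continuous (fun tx' : R * 'rV[R]_n => tx tx'.1 tx'.2).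
Proof.
apply: continuous_row => j; case: (split_ordP j) => k ->.
  rewrite (_ : (fun _ => _) = fst); first by move=> y; exact: cvg_fst.
  by apply/funext => y; rewrite tx_l.
rewrite (_ : (fun _ => _) = (fun x : 'rV[R]_n => x 0 k) \o snd).
  move=> y; apply: continuous_comp; last exact: coord_continuous.
  exact: cvg_snd.
by apply/funext => y; rewrite tx_r.
Qed.

Lemma continuous_txl a x : continuous a -> continuous (fun t => a (tx t x)).
Proof.
move=> ca t; apply: (@continuous_comp _ _ _ (fun t => tx t x) a); last exact: ca.
move: t; apply: continuous_row => j; case: (split_ordP j) => k ->.
  by under eq_fun do rewrite tx_l; move=> t; exact: cvg_id.
by under eq_fun do rewrite tx_r; exact: cst_continuous.
Qed.

(** Near each t of the unit interval the estimate holds on a product neighbourhood of (t, x);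
    compactness of the interval makes the neighbourhood of x independent of t. *)
Lemma tx_uniform a x e : continuous a -> 0 < e ->
  \forall y \near x, forall t, 0 <= t <= 1 -> `|a (tx t y) - a (tx t x)| < e.
Proof.
move=> ca e0.
have := (compact_near_coveringP _).1 (segment_compact (R := R) (a := 0) (b := 1)).
move=> /(_ _ (nbhs x) (fun y t => `|a (tx t y) - a (tx t x)| < e) _) H.
suff /H : forall t : R, `[0, 1]%classic t ->
    \forall t' \near t & y \near x, `|a (tx t' y) - a (tx t' x)| < e.
  apply: filterS => y Hy t t01; apply: Hy; rewrite /= in_itv /=; exact: t01.
move=> t _.
(* [d] vanishes at (t, x), so its continuity there is the required local estimate. *)
pose d (p : R * 'rV[R]_n) := a (tx p.1 p.2) - a (tx p.1 x).
have cd : continuous d.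
  move=> p; apply: continuousB.
    apply: (@continuous_comp _ _ _ (fun p : R * 'rV[R]_n => tx p.1 p.2) a).
      exact: continuous_tx.
    exact: ca.
  apply: (@continuous_comp _ _ _ fst (fun t => a (tx t x))).
    exact: cvg_fst.
  exact: continuous_txl.
have /cvgrPdist_lt /(_ e e0) := cd (t, x).
apply: filterS => -[t' y].
by rewrite /d /= subrr sub0r normrN.
Qed.

Definition pint a : 'rV[R]_n -> R := fun x => int01 (fun t => a (tx t x)).

Lemma continuous_pint a : continuous a -> continuous (pint a).
Proof.
move=> ca x; apply/(@cvgrPdist_le _ _ _ (nbhs x) (nbhs_filter x)) => e e0.
apply: (@filterS _ _ (nbhs_filter x) _ _ _ (tx_uniform x ca e0)) => y Hy.
rewrite /pint -int01B; try exact: continuous_txl.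
apply: int01_bound => [t|t t01]; last by rewrite distrC ltW ?Hy.
by apply: continuousB; exact: continuous_txl.
Qed.

(** By the mean value theorem the difference quotient of the integrand is its partial derivative at
    a point displaced by at most |h| in direction i. By [tx_uniform] this is close to the derivative
    at x uniformly in t, so the integrals are close too. *)
Lemma is_derive_pint a i x :
  (forall y, derivable a y (ebase R (rshift 1 i))) -> continuous a ->
  continuous (partial (rshift 1 i) a) ->
  is_derive x (ebase R i) (pint a) (pint (partial (rshift 1 i) a) x).
Proof.
move=> da ca cd.
suff H : (fun h : R => h^-1 *: (pint a (h *: ebase R i + x) - pint a x)) @ 0^'
    --> pint (partial (rshift 1 i) a) x.
  split; first by apply/cvg_ex; exists (pint (partial (rshift 1 i) a) x).
  by apply: cvg_lim.
apply/cvgrPdist_le => e e0.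
have /nbhs_normP[d /= d0 Hd] := tx_uniform x cd e0.
(* [M] exceeds |e_i|, so |h| < d / M keeps all intermediate points within d of x. *)
pose M := `|ebase R i| + 1; have M0 : 0 < M by rewrite ltr_wpDl.
have dM0 : 0 < d / M by rewrite divr_gt0.
near=> h.
have h0 : h != 0 by near: h; exact: nbhs_dnbhs_neq.
have hd : `|h| < d / M by near: h; exact: dnbhs0_lt.
(* The inequality is multiplied by |h|, so that increments replace difference quotients. *)
rewrite distrC -[_ *: _]/(_ * _) -(ler_pM2l (_ : 0 < `|h|)) ?normr_gt0 // -normrM.
rewrite mulrBr mulVKf // (addrC (h *: _)).
have c1 := continuous_txl (x := x + h *: ebase R i) ca.
have c2 := continuous_txl (x := x) ca; have c3 := continuous_txl (x := x) cd.
have c12 : continuous (fun t => a (tx t (x + h *: ebase R i)) - a (tx t x)).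
  by move=> t; apply: continuousB; [exact: c1|exact: c2].
have ch3 : continuous (fun t => h * partial (rshift 1 i) a (tx t x)).
  by move=> t; exact: cvgMl_tmp (c3 t).
rewrite /pint -(int01Z h c3) -(int01B c1 c2) -(int01B c12 ch3).
apply: int01_bound => [t|t t01].
  exact: continuousB (c12 t) (ch3 t).
have [c ch E] := mvt_line_signed (tx t x) h da.
rewrite tx_addr E -mulrBr normrM ler_wpM2l //; apply: ltW.
have := Hd (x + c *: ebase R i) _ t t01; rewrite tx_addr; apply => /=.
rewrite opprD addrA subrr sub0r normrN normrZ.
apply: le_lt_trans (_ : `|h| * M < d); last by rewrite -ltr_pdivlMr.
by rewrite ler_pM // lerDl.
Unshelve. all: by end_near. Qed.

Lemma partial_pint a i : smoothr a ->
  partial i (pint a) = pint (partial (rshift 1 i) a).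
Proof.
move=> sa; apply/funext => x.
by have [_] := is_derive_pint x (smoothr_derivable sa _) (smoothr_continuous sa)
  (smoothr_continuous (smoothr_partial (rshift 1 i) sa)).
Qed.

Lemma smoothr_pint a : smoothr a -> smoothr (pint a).
Proof.
move=> sa; apply/smoothrP => k; elim: k a sa => [|k IH] a sa.
  by split=> //; exact: continuous_pint (smoothr_continuous sa).
apply/CrS; split=> [|x i|i].
- exact: continuous_pint (smoothr_continuous sa).
- by have [] := is_derive_pint x (smoothr_derivable sa _) (smoothr_continuous sa)
    (smoothr_continuous (smoothr_partial (rshift 1 i) sa)).
- by rewrite partial_pint //; exact: IH (smoothr_partial _ sa).
Qed.

Definition cylinder (A : set 'rV[R]_n) : set 'rV[R]_(1 + n) :=
  [set tx p.1 p.2 | p in `[0, 1]%classic `*` A].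

Lemma compact_cylinder A : compact A -> compact (cylinder A).
Proof.
move=> cA; apply: continuous_compact.
  exact: continuous_subspaceT continuous_tx.
by apply: compact_setX => //; exact: segment_compact.
Qed.

(** Derivatives pass under the integral sign, and an integral over an interval of length one is
    bounded by any bound of its integrand. *)
Lemma jet_le_pint k (A : set 'rV[R]_n) e a : smoothr a ->
  jet_le k (cylinder A) e a -> jet_le k A e (pint a).
Proof.
elim: k a => [|k IH] a sa [ba pa]; (split=> [x Ax|//]); last first.
  by move=> i; rewrite partial_pint //; exact: IH (smoothr_partial _ sa) (pa _).
all: apply: int01_bound => [|t t01]; first exact: continuous_txl (smoothr_continuous sa).
all: by apply: ba; exists (t, x) => //=; split=> //=; rewrite in_itv.
Qed.

Lemma pint_FTC a x : smoothr a ->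
  pint (partial (lshift n ord0) a) x = a (tx 1 x) - a (tx 0 x).
Proof.
move=> sa; rewrite /pint.
apply: (@int01_FTC _ (fun t => a (tx t x))).
  exact: continuous_txl (smoothr_continuous (smoothr_partial _ sa)).
move=> t.
have E : (fun h : R => h^-1 *: (a (tx (h *: (1 : R) + t) x) - a (tx t x))) =
    (fun h : R => h^-1 *: (a (h *: ebase R (lshift n ord0) + tx t x) - a (tx t x))).
  by apply/funext => h; rewrite [h *: (1 : R)]mulr1 tx_addl.
have := smoothr_derivable sa (lshift n ord0) (tx t x).
by split; rewrite /partial /derivable /derive /= E.
Qed.

End ParamIntegral.

(** * Integration along rays *)

Section DirectionalCalculus.
Variable R : realType.

Lemma is_derive_comp1 (V : normedModType R) (s : V -> R) (phi : R -> R) x e s' phi' :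
  is_derive x e s s' -> is_derive (s x) 1 phi phi' ->
  is_derive x e (fun y => phi (s y)) (phi' * s').
Proof.
move=> [ds <-] [dphi <-].
have dphi' : differentiable phi (s x) by apply/derivable1_diffP.
suff -> : 'D_1 phi (s x) * 'D_e s x = 'd phi (s x) ('D_e s x).
  exact: is_derive_comp.
by rewrite (diff1E dphi') derive1E mulrC.
Qed.

Lemma is_deriveMr (V : normedModType R) (f g : V -> R) x e f' g' :
  is_derive x e f f' -> is_derive x e g g' ->
  is_derive x e (fun y => f y * g y) (f x * g' + g x * f').
Proof. by move=> df dg; exact: is_deriveM. Qed.

Lemma is_deriveDr (V : normedModType R) (f g : V -> R) x e f' g' :
  is_derive x e f f' -> is_derive x e g g' ->
  is_derive x e (fun y => f y + g y) (f' + g').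
Proof. by move=> df dg; exact: is_deriveD. Qed.

Lemma is_derive_eqr (V : normedModType R) (f : V -> R) x e (a b : R) :
  is_derive x e f a -> a = b -> is_derive x e f b.
Proof. by move=> ? <-. Qed.

Lemma smoothr_is_derive n (f : 'rV[R]_n -> R) x v : smoothr f ->
  is_derive x v f (\sum_i v 0 i * partial i f x).
Proof.
move=> /smoothrP /(_ 1%N) /(Cr_diff x)[df dfE].
by split; [exact: diff_derivable|rewrite deriveE].
Qed.

Lemma smoothr_univariate (P : (R -> R) -> Prop) :
  (forall phi, P phi -> exists2 phi', P phi' & forall t : R, is_derive t 1 phi (phi' t)) ->
  forall n (f : 'rV[R]_n -> R) phi, P phi -> smoothr f -> smoothr (fun x => phi (f x)).
Proof.
move=> HP n f phi Pphi /smoothrP sf; apply/smoothrP => k.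
exact: (Cr_univariate HP).
Qed.

Lemma smoothr_expR n (f : 'rV[R]_n -> R) : smoothr f -> smoothr (fun x => expR (f x)).
Proof.
apply: (@smoothr_univariate (fun phi => phi = @expR R)) => // phi ->.
by exists (@expR R) => // t; exact: is_derive_expR.
Qed.

(** Neither cosine nor sine alone is stable under differentiation, but their span is. *)
Let trig (phi : R -> R) := exists a b, phi = (fun t => a * cos t + b * sin t).

Let trigP phi : trig phi ->
  exists2 phi', trig phi' & forall t : R, is_derive t 1 phi (phi' t).
Proof.
move=> [a [b ->]]; exists (fun t => b * cos t + (- a) * sin t); first by exists b, (- a).
move=> t.
have -> : b * cos t + - a * sin t = (a * (- sin t) + cos t * 0) + (b * cos t + sin t * 0).
  by rewrite !mulr0 !addr0 addrC mulNr mulrN.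
by apply: is_deriveDr; apply: is_deriveMr; exact: is_derive_cst.
Qed.

Lemma smoothr_cos n (f : 'rV[R]_n -> R) : smoothr f -> smoothr (fun x => cos (f x)).
Proof.
apply: (smoothr_univariate trigP); exists 1, 0.
by apply/funext => t; rewrite mul1r mul0r addr0.
Qed.

Lemma smoothr_sin n (f : 'rV[R]_n -> R) : smoothr f -> smoothr (fun x => sin (f x)).
Proof.
apply: (smoothr_univariate trigP); exists 0, 1.
by apply/funext => t; rewrite mul1r mul0r add0r.
Qed.

End DirectionalCalculus.

(** * The solution operator in real and imaginary parts *)

Section Operator.
Variables (R : realType) (n : nat) (v : 'rV[R]_n) (Gam : 'rV[R]_n -> R) (la mu : R).
Hypotheses (v0 : v != 0) (sGam : smoothr Gam).
Implicit Types (x : 'rV[R]_n) (z : 'rV[R]_(1 + n)) (g : 'rV[R]_n -> R).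

Definition height x : R := dotr x v / dotr v v.
Definition foot x : 'rV[R]_n := x - height x *: v.
Definition offset x : R := height x - Gam (foot x).

Lemma dotrL t x y : dotr (t *: x + y) v = t * dotr x v + dotr y v.
Proof.
rewrite /dotr mulr_sumr -big_split /=; apply: eq_bigr => i _.
by rewrite !mxE mulrDl mulrA.
Qed.

Lemma dotr_gt0 : 0 < dotr v v.
Proof.
rewrite lt0r; apply/andP; split; last by apply: sumr_ge0 => i _; exact: sqr_ge0.
apply: contra v0 => /eqP/psumr_eq0P vv.
apply/eqP/rowP => i; rewrite mxE; apply/eqP; rewrite -sqrf_eq0 expr2.
by apply/eqP/vv => // j _; exact: sqr_ge0.
Qed.

Lemma height_line t x : height (t *: v + x) = t + height x.
Proof. by rewrite /height dotrL mulrDl mulfK // gt_eqF // dotr_gt0. Qed.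

Lemma foot_line t x : foot (t *: v + x) = foot x.
Proof.
by rewrite /foot height_line scalerDl opprD addrACA subrr add0r.
Qed.

Lemma offset_line t x : offset (t *: v + x) = t + offset x.
Proof. by rewrite /offset height_line foot_line addrA. Qed.

Lemma smoothr_height : smoothr height.
Proof.
rewrite /height /dotr; apply: smoothrM (smoothr_cst _).
apply: smoothr_sum => i.
exact: smoothrM (smoothr_coord i) (smoothr_cst _).
Qed.

Lemma smoothr_offset : smoothr offset.
Proof.
apply: smoothrD smoothr_height (smoothrN (smoothr_comp sGam _)) => i.
under eq_fun do rewrite !mxE.
apply: smoothrD (smoothr_coord i) (smoothrN _).
exact: smoothrM smoothr_height (smoothr_cst _).
Qed.

(** [foot] is constant on lines parallel to v, so along v only [height] varies, at unit speed. *)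
Lemma sum_partial_offset x : \sum_i v 0 i * partial i offset x = 1.
Proof.
have [_ <-] := smoothr_is_derive x v smoothr_offset.
have E : (fun h : R => h^-1 *: (offset (h *: v + x) - offset x)) =
    (fun h : R => h^-1 *: (id (h *: (1 : R) + 0) - id 0)).
  apply/funext => h; congr (_ *: _).
  by rewrite offset_line addrK subr0 addr0 [h *: (1 : R)]mulr1.
by rewrite /derive /= E; exact: derive_id.
Qed.

Definition time z : R := z 0 (lshift n ord0).
Definition space z : 'rV[R]_n := \row_j z 0 (rshift 1 j).

Lemma time_tx t x : time (tx t x) = t.
Proof. exact: tx_l. Qed.

Lemma space_tx t x : space (tx t x) = x.
Proof. by apply/rowP => j; rewrite mxE tx_r. Qed.

Lemma smoothr_time : smoothr time.
Proof. exact: smoothr_coord. Qed.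

Lemma smoothr_space i : smoothr (fun z => space z 0 i).
Proof. by under eq_fun do rewrite mxE; exact: smoothr_coord. Qed.

(** This is u w(x), the length in units of v of the way back from x; [ray] is the point x - u w(x) v
    reached. *)
Definition depth z : R := time z * offset (space z).
Definition ray z : 'rV[R]_n := space z - depth z *: v.

Lemma smoothr_depth : smoothr depth.
Proof. exact: smoothrM smoothr_time (smoothr_comp smoothr_offset smoothr_space). Qed.

Lemma smoothr_ray i : smoothr (fun z => ray z 0 i).
Proof.
under eq_fun do rewrite !mxE.
apply: smoothrD (smoothr_coord _) (smoothrN _).
exact: smoothrM smoothr_depth (smoothr_cst _).
Qed.

(* The field (1 - u) d/du + w v.D, along which [ray] is constant. *)
Definition transp z : 'rV[R]_(1 + n) := tx (1 - time z) (offset (space z) *: v).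

(** The product rule gives (1 - u) w + u w (v.D w), and v.D w = 1 by [sum_partial_offset]. *)
Lemma is_derive_depth z : is_derive z (transp z) depth (offset (space z)).
Proof.
have Dp i : is_derive z (transp z) (fun z => space z 0 i) (offset (space z) * v 0 i).
  under eq_fun do rewrite mxE.
  split; first exact: derivable_coord.
  by rewrite derive_coord tx_r mxE.
have Du : is_derive z (transp z) time (1 - time z).
  split; first exact: derivable_coord.
  by rewrite derive_coord tx_l.
have Cd : Cr 1 offset by exact: (smoothrP _).1 smoothr_offset 1%N.
have Dd : is_derive z (transp z) (fun z => offset (space z)) (offset (space z)).
  have dp i : derivable (fun z => space z 0 i) z (transp z) by have [] := Dp i.
  have E : \sum_i partial i offset (space z) * 'D_(transp z) (fun z => space z 0 i) z =
      offset (space z).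
    rewrite -[RHS]mulr1 -(sum_partial_offset (space z)) mulr_sumr.
    by apply: eq_bigr => i _; have [_ ->] := Dp i; rewrite mulrCA (mulrC (partial _ _ _)).
  exact: is_derive_eqr (is_derive_comp_row dp Cd) E.
by apply: is_derive_eqr (is_deriveMr Du Dd) _; ring.
Qed.

(** In the i-th coordinate of [ray] the contribution w v_i of the space variable cancels against
    that of [depth]; the chain rule does the rest. *)
Lemma is_derive_ray g z : smoothr g ->
  is_derive z (transp z) (fun z => g (ray z)) 0.
Proof.
move=> sg.
have Dr i : is_derive z (transp z) (fun z => ray z 0 i) 0.
  under eq_fun do rewrite !mxE -mulrN.
  have -> : 0 = offset (space z) * v 0 i + (depth z * 0 + (- v 0 i) * offset (space z)).
    by rewrite mulr0 add0r mulNr mulrC subrr.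
  apply: is_deriveDr.
    split; first exact: derivable_coord.
    by rewrite derive_coord tx_r mxE.
  exact: is_deriveMr (is_derive_depth z) (is_derive_cst _ _ _).
have -> : 0 = \sum_i partial i g (ray z) * 'D_(transp z) (fun z => ray z 0 i) z.
  by rewrite big1 // => i _; have [_ ->] := Dr i; rewrite mulr0.
apply: is_derive_comp_row => [i|]; first by have [] := Dr i.
exact: (smoothrP _).1 sg 1%N.
Qed.

(** [ecos] and [esin] are the real and imaginary parts of exp(lambda u w), where lambda = la + i
    mu. *)
Definition ecos z := expR (la * depth z) * cos (mu * depth z).
Definition esin z := expR (la * depth z) * sin (mu * depth z).

Lemma smoothr_ecos : smoothr ecos.
Proof.
apply: smoothrM; first apply: smoothr_expR; last apply: smoothr_cos;
  exact: smoothrM (smoothr_cst _) smoothr_depth.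
Qed.

Lemma smoothr_esin : smoothr esin.
Proof.
apply: smoothrM; first apply: smoothr_expR; last apply: smoothr_sin;
  exact: smoothrM (smoothr_cst _) smoothr_depth.
Qed.

Lemma is_derive_ecos z :
  is_derive z (transp z) ecos (offset (space z) * (la * ecos z - mu * esin z)).
Proof.
have D c := is_deriveMr (is_derive_cst c z (transp z)) (is_derive_depth z).
apply: is_derive_eqr (is_deriveMr (is_derive_comp1 (D la) (is_derive_expR _))
  (is_derive_comp1 (D mu) (is_derive_cos _))) _.
rewrite /ecos /esin /=; ring.
Qed.

Lemma is_derive_esin z :
  is_derive z (transp z) esin (offset (space z) * (la * esin z + mu * ecos z)).
Proof.
have D c := is_deriveMr (is_derive_cst c z (transp z)) (is_derive_depth z).
apply: is_derive_eqr (is_deriveMr (is_derive_comp1 (D la) (is_derive_expR _))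
  (is_derive_comp1 (D mu) (is_derive_sin _))) _.
rewrite /ecos /esin /=; ring.
Qed.

(** With g1 + i g2 the function to be integrated, the coefficients ([ecos], -[esin]) give the real
    part of the complex integrand and ([esin], [ecos]) its imaginary part. *)
Definition integrand (c1 c2 : 'rV[R]_(1 + n) -> R) g1 g2 z :=
  c1 z * g1 (ray z) + c2 z * g2 (ray z).

Lemma smoothr_integrand c1 c2 g1 g2 : smoothr c1 -> smoothr c2 ->
  smoothr g1 -> smoothr g2 -> smoothr (integrand c1 c2 g1 g2).
Proof.
move=> s1 s2 t1 t2.
exact: smoothrD (smoothrM s1 (smoothr_comp t1 smoothr_ray))
  (smoothrM s2 (smoothr_comp t2 smoothr_ray)).
Qed.

Definition opR c1 c2 g1 g2 x := offset x * pint (integrand c1 c2 g1 g2) x.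

Lemma smoothr_opR c1 c2 g1 g2 : smoothr c1 -> smoothr c2 ->
  smoothr g1 -> smoothr g2 -> smoothr (opR c1 c2 g1 g2).
Proof.
move=> s1 s2 t1 t2; apply: smoothrM smoothr_offset (smoothr_pint _).
exact: smoothr_integrand.
Qed.

(** The union of the segments over which the operator integrates for base points in A. *)
Definition rays (A : set 'rV[R]_n) := ray @` cylinder A.

Lemma compact_rays A : compact A -> compact (rays A).
Proof.
move=> cA; apply: continuous_compact; last exact: compact_cylinder.
apply: continuous_subspaceT; apply: continuous_row => i.
exact: smoothr_continuous (smoothr_ray i).
Qed.

Lemma jet_le_opR k A c1 c2 : compact A -> smoothr c1 -> smoothr c2 ->
  exists2 B, 0 <= B & forall g1 g2 e, smoothr g1 -> smoothr g2 -> 0 <= e ->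
    jet_le k (rays A) e g1 -> jet_le k (rays A) e g2 ->
    jet_le k A (B * e) (opR c1 c2 g1 g2).
Proof.
move=> cA s1 s2; have cC := compact_cylinder cA.
have [B0 B00 b0] := jet_le_compact k cA smoothr_offset.
have [B1 B10 b1] := jet_le_compact k cC s1.
have [B2 B20 b2] := jet_le_compact k cC s2.
have [B B0' bB] := jet_le_comp k cC smoothr_ray.
(* The outer factor comes from the product with [offset], the inner ones from the products with c1
   and c2, and [B] from the composition with [ray]. *)
exists (2 ^+ k * (B0 * (2 ^+ k * (B1 * B) + 2 ^+ k * (B2 * B)))).
  by rewrite !mulr_ge0 // addr_ge0 // !mulr_ge0.
move=> g1 g2 e t1 t2 e0 bg1 bg2.
have r1 := smoothr_comp t1 smoothr_ray; have r2 := smoothr_comp t2 smoothr_ray.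
have sI := smoothr_integrand s1 s2 t1 t2.
rewrite -mulrA -mulrA mulrDl -!mulrA.
have Be0 : 0 <= B * e by exact: mulr_ge0.
apply: (jet_leM smoothr_offset (smoothr_pint sI)) => //.
  by rewrite addr_ge0 // !mulr_ge0.
apply: jet_le_pint => //.
apply: jet_leD (smoothrM s1 r1) (smoothrM s2 r2) _ _.
  exact: jet_leM s1 r1 B10 Be0 b1 (bB _ _ t1 e0 bg1).
exact: jet_leM s2 r2 B20 Be0 b2 (bB _ _ t2 e0 bg2).
Qed.

(** Write w for [offset], P for the integral of p and s for the v-derivative of p in space. Since
    v.D w = 1, the left side is P + w int s. The hypothesis reads (1 - u) d_u p + w s = w r, and
    integration by parts gives int (1 - u) d_u p = P - p(0), so that P cancels. *)
Lemma transport_ode p r x : smoothr p -> smoothr r ->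
  (forall z, is_derive z (transp z) p (offset (space z) * r z)) ->
  \sum_j v 0 j * partial j (fun x => offset x * pint p x) x =
  offset x * pint r x + p (tx 0 x).
Proof.
move=> sp sr Dp.
have su := smoothrD (smoothr_cst 1) (smoothrN smoothr_time).
(* The factor 1 - u vanishes at u = 1, which leaves only the boundary term at u = 0. *)
pose h z := (1 + - time z) * p z.
have sh : smoothr h := smoothrM su sp.
pose s z := \sum_j v 0 j * partial (rshift 1 j) p z.
have sm j := smoothrM (smoothr_cst (v 0 j)) (smoothr_partial (rshift 1 j) sp).
have ss : smoothr s := smoothr_sum (index_enum 'I_n) sm.
have dh z : partial (lshift n ord0) h z =
    (1 - time z) * partial (lshift n ord0) p z - p z.
  have Du : is_derive z (ebase R (lshift n ord0)) (fun z => 1 + - time z) (0 + - 1).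
    apply: is_deriveDr (is_derive_cst (1 : R) z _) (is_deriveN _).
    split; first exact: derivable_coord.
    by rewrite derive_coord mxE !eqxx.
  have [_] := is_deriveMr Du (derivableP (smoothr_derivable sp (lshift n ord0) z)).
  rewrite -/(partial _ _ _) -/(partial _ _ _) => ->.
  by rewrite add0r mulrN1.
(* Integration by parts in the first coordinate. *)
have pE : offset x * pint s x + (h (tx 1 x) - h (tx 0 x)) + pint p x = offset x * pint r x.
  rewrite -(pint_FTC x sh) /pint.
  have cs := continuous_txl (x := x) (smoothr_continuous ss).
  have ch := continuous_txl (x := x)
    (smoothr_continuous (smoothr_partial (lshift n ord0) sh)).
  have cp := continuous_txl (x := x) (smoothr_continuous sp).
  have cr := continuous_txl (x := x) (smoothr_continuous sr).
  have cds : continuous (fun t => offset x * s (tx t x)).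
    by move=> t; exact: cvgMl_tmp (cs t).
  have cdsh : continuous
      (fun t => offset x * s (tx t x) + partial (lshift n ord0) h (tx t x)).
    by move=> t; exact: cvgD (cds t) (ch t).
  rewrite -(int01Z _ cs) -(int01Z _ cr) -(int01D cds ch) -(int01D cdsh cp).
  congr (int01 _); apply/funext => t.
  rewrite dh addrA subrK time_tx.
  have [_ E1] := Dp (tx t x); have [_] := smoothr_is_derive (tx t x) (transp (tx t x)) sp.
  rewrite E1 space_tx => ->; rewrite big_split_ord /= big_ord1 tx_l time_tx addrC.
  congr (_ + _); rewrite /s mulr_sumr; apply: eq_bigr => j _.
  by rewrite tx_r mxE space_tx mulrA.
rewrite /h !time_tx subrr subr0 mul0r mul1r sub0r in pE.
have sP := smoothr_pint sp.
have -> : \sum_j v 0 j * partial j (fun x => offset x * pint p x) x =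
    offset x * pint s x + pint p x.
  have -> : pint s x = \sum_j v 0 j * partial j (pint p) x.
    rewrite /pint /s.
    have cont j := continuous_txl (x := x)
      (smoothr_continuous (smoothr_partial (rshift 1 j) sp)).
    under [RHS]eq_bigr do rewrite partial_pint // /pint -(int01Z _ (cont _)).
    have contZ j : continuous (fun t => v 0 j * partial (rshift 1 j) p (tx t x)).
      by move=> t; exact: cvgMl_tmp (cont j t).
    (* Induction over the list of indices exchanges the finite sum with the integral. *)
    elim: (index_enum _) => [|j J IH].
      rewrite big_nil; under eq_fun do rewrite big_nil.
      by rewrite -[X in int01 X]/(fun t : R => 0) /int01 Rintegral_cst // mul0r.
    rewrite big_cons -IH -int01D //; first by under eq_fun do rewrite big_cons.
    exact: continuous_txl (smoothr_continuous (smoothr_sum J sm)).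
  rewrite -[X in _ + X]mulr1 -(sum_partial_offset x) !mulr_sumr -big_split /=.
  apply: eq_bigr => j _.
  rewrite (partialM (smoothr_derivable smoothr_offset j) (smoothr_derivable sP j)).
  by rewrite mulrDr; congr (_ + _); rewrite mulrCA.
by rewrite -pE addrAC subrK.
Qed.

Lemma pint_lin a b (p q : 'rV[R]_(1 + n) -> R) x : smoothr p -> smoothr q ->
  pint (fun z => a * p z + b * q z) x = a * pint p x + b * pint q x.
Proof.
move=> sp sq; rewrite /pint.
have cp := continuous_txl (x := x) (smoothr_continuous sp).
have cq := continuous_txl (x := x) (smoothr_continuous sq).
rewrite -(int01Z a cp) -(int01Z b cq) int01D //.
  by move=> t; exact: cvgMl_tmp (cp t).
by move=> t; exact: cvgMl_tmp (cq t).
Qed.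

Definition opRe g1 g2 := opR ecos (fun z => - esin z) g1 g2.
Definition opIm g1 g2 := opR esin ecos g1 g2.

Lemma ray_tx0 x : ray (tx 0 x) = x.
Proof. by rewrite /ray /depth time_tx mul0r scale0r subr0 space_tx. Qed.

Lemma depth_tx0 x : depth (tx 0 x) = 0.
Proof. by rewrite /depth time_tx mul0r. Qed.

(** Since g1 and g2 along [ray] are constant for the transport field, it differentiates only the
    exponential, which reproduces the real part of lambda times the integrand. At u = 0 the
    exponential is 1 and [ray] is at x, so the boundary term is g1 x. *)
Lemma ode_Re g1 g2 x : smoothr g1 -> smoothr g2 ->
  \sum_j v 0 j * partial j (opRe g1 g2) x =
  la * opRe g1 g2 x - mu * opIm g1 g2 x + g1 x.
Proof.
move=> t1 t2.
have sp := smoothr_integrand smoothr_ecos (smoothrN smoothr_esin) t1 t2.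
have sq := smoothr_integrand smoothr_esin smoothr_ecos t1 t2.
have sr : smoothr (fun z => la * integrand ecos (fun z => - esin z) g1 g2 z +
    (- mu) * integrand esin ecos g1 g2 z).
  exact: smoothrD (smoothrM (smoothr_cst _) sp) (smoothrM (smoothr_cst _) sq).
have Dp z : is_derive z (transp z) (integrand ecos (fun z => - esin z) g1 g2)
    (offset (space z) * (la * integrand ecos (fun z => - esin z) g1 g2 z +
      (- mu) * integrand esin ecos g1 g2 z)).
  apply: is_derive_eqr (is_deriveDr (is_deriveMr (is_derive_ecos z) (is_derive_ray z t1))
    (is_deriveMr (is_deriveN (is_derive_esin z)) (is_derive_ray z t2))) _.
  by rewrite /integrand; ring.
rewrite /opRe /opR (transport_ode x sp sr Dp).
rewrite pint_lin // /opIm /opR; congr (_ + _); first by ring.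
by rewrite /integrand ray_tx0 /ecos /esin depth_tx0 !mulr0 expR0 cos0 sin0; ring.
Qed.

Lemma ode_Im g1 g2 x : smoothr g1 -> smoothr g2 ->
  \sum_j v 0 j * partial j (opIm g1 g2) x =
  la * opIm g1 g2 x + mu * opRe g1 g2 x + g2 x.
Proof.
move=> t1 t2.
have sp := smoothr_integrand smoothr_ecos (smoothrN smoothr_esin) t1 t2.
have sq := smoothr_integrand smoothr_esin smoothr_ecos t1 t2.
have sr : smoothr (fun z => la * integrand esin ecos g1 g2 z +
    mu * integrand ecos (fun z => - esin z) g1 g2 z).
  exact: smoothrD (smoothrM (smoothr_cst _) sq) (smoothrM (smoothr_cst _) sp).
have Dp z : is_derive z (transp z) (integrand esin ecos g1 g2)
    (offset (space z) * (la * integrand esin ecos g1 g2 z +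
      mu * integrand ecos (fun z => - esin z) g1 g2 z)).
  apply: is_derive_eqr (is_deriveDr (is_deriveMr (is_derive_esin z) (is_derive_ray z t1))
    (is_deriveMr (is_derive_ecos z) (is_derive_ray z t2))) _.
  by rewrite /integrand; ring.
rewrite /opIm /opR (transport_ode x sq sr Dp).
rewrite pint_lin // /opRe /opR; congr (_ + _); first by ring.
by rewrite /integrand ray_tx0 /ecos /esin depth_tx0 !mulr0 expR0 cos0 sin0; ring.
Qed.

End Operator.

(** * Smooth functions and Whitney functions *)

Section SmoothTopology.
Variables (R : realType) (n : nat).
Implicit Types (F G H : smoothfun R n) (A : set 'rV[R]_n) (b : mindex n).

(** The jet map and the projection to its component b are continuous, and uniform e-closeness on a
    compact set is a neighbourhood for compact convergence. *)
Lemma cmpartial_near F b A (e : R) : compact A -> 0 < e ->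
  \forall G \near F, forall x, A x ->
    `|cmpartial b F x - cmpartial b (G : smoothfun R n) x| < e%:C.
Proof.
move=> cA e0; have e0' : 0 < e%:C by rewrite ltcR.
have N := @fam_nbhs 'rV[R]_n _ compact A _
  (smooth_jet F b : {family compact, 'rV[R]_n -> R[i]^o})
  (entourage_ball _ (PosNum e0')) cA.
have c1 := @proj_continuous _ (fun _ : mindex n => {family compact, 'rV[R]_n -> R[i]^o})
  b (smooth_jet F) _ N.
exact: (@initial_continuous _ _ (@smooth_jet R n) F _ c1).
Qed.

Lemma continuous_smoothfun (T : topologicalType) (f : T -> smoothfun R n) :
  (forall t b A (e : R), compact A -> 0 < e ->
    \forall t' \near t, forall x, A x ->
      `|cmpartial b (f t) x - cmpartial b (f t') x| < e%:C) ->
  continuous f.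
Proof.
move=> near_f; apply: (@continuous_comp_initial _ _ _ (@smooth_jet R n)) => t.
apply/cvg_sup => b; move: t.
apply: (@continuous_comp_initial _ T _ (@^~ b)) => t.
apply/fam_cvgP => A cA U /uniform_nbhs[E [entE EU]].
move: entE; rewrite -entourage_ballE => -[d /= d0 dE].
(* A positive element of [R[i]] has imaginary part zero, so the radius is a real number. *)
have dR : d = (complex.Re d)%:C.
  by move: d0; case: (d) => dr di; rewrite ltcE /= => /andP[/eqP -> _].
have d0' : 0 < complex.Re d by rewrite -ltcR -dR.
apply: filterS (near_f t b A _ cA d0') => t' Ht'.
apply: EU => x Ax; apply: dE.
by rewrite /ball /= dR; exact: Ht'.
Qed.

Definition wcount (s : seq 'I_n) : mindex n := [ffun i => count_mem i s].

(** This links the words in [jet_le] with the multi-indices in the topology: the order of the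
    derivatives of a smooth function is immaterial. *)
Lemma partials_wcount s (f : 'rV[R]_n -> R) : smoothr f ->
  partials s f = mpartial (wcount s) f.
Proof.
move=> sf; rewrite mpartialE; apply: partials_perm => //.
by apply/allP => i _ /=; rewrite count_mword ffunE.
Qed.

Definition Ref F : 'rV[R]_n -> R := fun x => complex.Re (F x).
Definition Imf F : 'rV[R]_n -> R := fun x => complex.Im (F x).

Lemma smoothr_Ref F : smoothr (Ref F).
Proof. by have /asboolP[sr _] := sfunP F; exact: sr. Qed.

Lemma smoothr_Imf F : smoothr (Imf F).
Proof. by have /asboolP[_ si] := sfunP F; exact: si. Qed.

Definition cjet_le k A e F := jet_le k A e (Ref F) /\ jet_le k A e (Imf F).

Lemma normc_le_ReIm (z : R[i]) : `|z| <= (`|complex.Re z| + `|complex.Im z|)%:C.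
Proof.
rewrite normc_def lecR -[leRHS]ger0_norm ?addr_ge0 // -sqrtr_sqr ler_wsqrtr //.
rewrite sqrrD !real_normK ?num_real // addrAC lerDl.
by rewrite mulrn_wge0 // mulr_ge0.
Qed.

Lemma normc_ge_Im (z : R[i]) : `|complex.Im z|%:C <= `|z|.
Proof. by rewrite normc_def lecR -sqrtr_sqr ler_wsqrtr // lerDr sqr_ge0. Qed.

Lemma cjet_leP k A (e : R) F :
  (forall s, (size s <= k)%N -> forall x, A x -> `|cmpartial (wcount s) F x| <= e%:C) ->
  cjet_le k A e F.
Proof.
move=> be; split; apply/jet_leP => s sk x Ax; rewrite -lecR; apply: le_trans (be s sk x Ax).
  rewrite (partials_wcount _ (smoothr_Ref F)).
  exact: (normc_ge_Re (cmpartial (wcount s) F x)).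
rewrite (partials_wcount _ (smoothr_Imf F)).
exact: (normc_ge_Im (cmpartial (wcount s) F x)).
Qed.

Lemma cmpartial_cjet_le b A e F : cjet_le (size (mword b)) A e F ->
  forall x, A x -> `|cmpartial b F x| <= (e + e)%:C.
Proof.
move=> [/jet_leP re /jet_leP im] x Ax; apply: le_trans (normc_le_ReIm _) _; rewrite lecR.
by apply: lerD; rewrite /= mpartialE; [exact: re|exact: im].
Qed.

Lemma near_cjet_le k A (e : R) F : compact A -> 0 < e ->
  \forall G \near F, cjet_le k A e ((-1) *: F + G).
Proof.
move=> cA e0.
(* The words of length at most k are finitely many, being tuples of some length l <= k, so their
   neighbourhoods intersect in a neighbourhood. *)
have N (l : 'I_k.+1) : \forall G \near F, forall s : l.-tuple 'I_n,
    forall x, A x ->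
    `|cmpartial (wcount s) F x - cmpartial (wcount s) (G : smoothfun R n) x| < e%:C.
  apply: (filter_forall (nbhs_filter F)) => s; exact: cmpartial_near.
apply: filterS (filter_forall (nbhs_filter F) N) => G FG.
apply: cjet_leP => s sk x Ax; rewrite cmpartialL scaleN1r addrC distrC ltW //.
by have := FG (Ordinal (sk : size s < k.+1)%N) (in_tuple s) x Ax.
Qed.

(** By linearity, L G - L F is the image of G - F, whose jet is small on [A'] for G near F. *)
Lemma bounded_continuous (L : {linear smoothfun R n -> smoothfun R n}) :
  (forall k A, compact A -> exists A' B, [/\ compact A', 0 <= B &
     forall F e, 0 <= e -> cjet_le k A' e F -> cjet_le k A (B * e) (L F)]) ->
  continuous L.
Proof.
move=> bL; apply: continuous_smoothfun => F b A e cA e0.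
have [A' [B [cA' B0 HB]]] := bL (size (mword b)) A cA.
(* The real and imaginary parts together give at most 2 B d; B + 1 makes this strictly less than e
   and the denominator positive. *)
pose d := e / (2 * (B + 1)).
have B1 : 0 < B + 1 by rewrite ltr_wpDl.
have d0 : 0 < d by rewrite divr_gt0 // mulr_gt0.
apply: filterS (near_cjet_le (size (mword b)) F cA' d0) => G /(HB _ _ (ltW d0)).
rewrite linearP => /cmpartial_cjet_le H x /H.
rewrite cmpartialL scaleN1r addrC distrC => /le_lt_trans; apply.
have dE : d * (2 * (B + 1)) = e by rewrite divfK // gt_eqF // mulr_gt0.
by rewrite ltcR -dE; nra.
Qed.

End SmoothTopology.

(** * Passage to the quotient by the functions flat on K *)

Section Descent.
Variables (R : realType) (n : nat) (K : set 'rV[R]_n).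

Lemma rK_linear : linear (rK K : smoothfun R n -> whitney K).
Proof. by move=> c F G; apply/val_inj; exact: restrL. Qed.

HB.instance Definition _ := GRing.isLinear.Build R[i] (smoothfun R n) (whitney K)
  _ (@rK R n K) rK_linear.

Lemma rK_surj (f : whitney K) : exists F, rK K F = f.
Proof. by have /asboolP[F Ff] := wjetP f; exists F; apply/val_inj. Qed.

(** S lifts, applies L and restricts. As L preserves the kernel of [rK], the result does not depend
    on the lift, which gives linearity although the lift is an arbitrary choice. Continuity follows
    from that of L, because openness in the quotient is tested after pulling back along [rK]. *)
Lemma whitney_descent (L : {linear smoothfun R n -> smoothfun R n}) :
  continuous L -> (forall F, rK K F = 0 -> rK K (L F) = 0) ->
  exists2 S : {linear whitney K -> whitney K},
    continuous (S : whitney K -> whitney K) & forall F, S (rK K F) = rK K (L F).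
Proof.
move=> cL L0.
pose ext f := sval (cid (rK_surj f)).
have extK f : rK K (ext f) = f by rewrite /ext; case: cid.
have Lr F G : rK K F = rK K G -> rK K (L F) = rK K (L G).
  move=> FG; apply/eqP; rewrite -subr_eq0 -!linearB; apply/eqP.
  by apply: L0; rewrite linearB /= FG subrr.
pose S f := rK K (L (ext f)).
have SE F : S (rK K F) = rK K (L F) by apply: Lr; rewrite extK.
have linS : linear S.
  move=> c f g; rewrite -[in LHS](extK f) -[in LHS](extK g) -rK_linear SE.
  by rewrite linearP rK_linear.
pose Sm := GRing.isLinear.Build _ _ _ _ _ linS.
pose Sl : {linear whitney K -> whitney K} := HB.pack S Sm.
exists Sl => //; apply/continuousP => U oU.
suff E : rK K @^-1` (Sl @^-1` U) = L @^-1` (rK K @^-1` U).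
  by change (open (rK K @^-1` (Sl @^-1` U))); rewrite E; apply: (continuousP _).1 => //.
by apply/funext => F; rewrite /preimage /= SE.
Qed.

Lemma smooth_partial_in (j : 'I_n) (F : smoothfun R n) :
  (fun x => partial j (Ref F) x +i* partial j (Imf F) x) \in @smooth_pred R n.
Proof.
apply/asboolP; split; first exact: smoothr_partial (smoothr_Ref F).
exact: smoothr_partial (smoothr_Imf F).
Qed.

Definition sD j F : smoothfun R n := SmoothFun (smooth_partial_in j F).

Lemma wD_rK j F : wD j (rK K F) = rK K (sD j F).
Proof.
apply/val_inj; apply/funext => b; apply/funext => x.
rewrite /= /jetD /restr /cmpartial.
by rewrite (mpartialS b j (smoothr_Ref F)) (mpartialS b j (smoothr_Imf F)).
Qed.

Lemma rK_eq0 F : rK K F = 0 <-> forall k, cjet_le k K 0 F.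
Proof.
split=> [F0 k|F0].
  apply: cjet_leP => s _ x Kx.
  have := congr1 (fun f : whitney K => f (wcount s) (SigSub (mem_set Kx))) F0.
  by rewrite /= /restr /= => ->; rewrite normr0.
apply/val_inj; apply/funext => b; apply/funext => x.
have := cmpartial_cjet_le (F0 (size (mword b))) (set_mem (valP x)).
by rewrite addr0 normr_le0 => /eqP.
Qed.

End Descent.

(** * The solution operator on complex smooth functions *)

Section Solution.
Variables (R : realType) (n : nat) (v : 'rV[R]_n) (Gam : 'rV[R]_n -> R) (lambda : R[i]).
Hypotheses (v0 : v != 0) (sGam : smoothr Gam).
Implicit Types F G : smoothfun R n.

Let la := complex.Re lambda.
Let mu := complex.Im lambda.

Lemma smoothr_opRe g1 g2 : smoothr g1 -> smoothr g2 -> smoothr (opRe v Gam la mu g1 g2).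
Proof.
move=> t1 t2.
exact: (smoothr_opR v sGam (smoothr_ecos v la mu sGam)
  (smoothrN (smoothr_esin v la mu sGam)) t1 t2).
Qed.

Lemma smoothr_opIm g1 g2 : smoothr g1 -> smoothr g2 -> smoothr (opIm v Gam la mu g1 g2).
Proof.
move=> t1 t2.
exact: (smoothr_opR v sGam (smoothr_esin v la mu sGam) (smoothr_ecos v la mu sGam) t1 t2).
Qed.

Lemma solve_in F : (fun x => opRe v Gam la mu (Ref F) (Imf F) x +i*
  opIm v Gam la mu (Ref F) (Imf F) x) \in @smooth_pred R n.
Proof.
apply/asboolP; split.
  exact: smoothr_opRe (smoothr_Ref F) (smoothr_Imf F).
exact: smoothr_opIm (smoothr_Ref F) (smoothr_Imf F).
Qed.

Definition solve F : smoothfun R n := SmoothFun (solve_in F).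

Lemma RefL (c : R[i]) F G x : Ref (c *: F + G) x =
  complex.Re c * Ref F x - complex.Im c * Imf F x + Ref G x.
Proof.
rewrite /Ref /Imf -[(c *: F + G) x]/(c * F x + G x).
by case: c (F x) (G x) => [? ?] [? ?] [? ?].
Qed.

Lemma ImfL (c : R[i]) F G x : Imf (c *: F + G) x =
  complex.Re c * Imf F x + complex.Im c * Ref F x + Imf G x.
Proof.
rewrite /Ref /Imf -[(c *: F + G) x]/(c * F x + G x).
by case: c (F x) (G x) => [? ?] [? ?] [? ?].
Qed.

Lemma smoothfun_eqP F G : Ref F =1 Ref G -> Imf F =1 Imf G -> F = G.
Proof.
move=> rFG iFG; apply/val_inj; apply/funext => x; apply/eqP.
by rewrite eq_complex; apply/andP; split; apply/eqP; [exact: rFG|exact: iFG].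
Qed.

(* Multiplying F by i exchanges, up to a sign t, the two coefficient pairs. *)
Lemma opR_complex_lin c1 c2 d1 d2 (t : R) (c : R[i]) F G x :
  smoothr c1 -> smoothr c2 -> smoothr d1 -> smoothr d2 ->
  (forall z, c1 z = - (t * d2 z)) -> (forall z, c2 z = t * d1 z) ->
  opR v Gam c1 c2 (Ref (c *: F + G)) (Imf (c *: F + G)) x =
  complex.Re c * opR v Gam c1 c2 (Ref F) (Imf F) x +
  t * complex.Im c * opR v Gam d1 d2 (Ref F) (Imf F) x +
  opR v Gam c1 c2 (Ref G) (Imf G) x.
Proof.
move=> s1 s2 t1 t2 c1E c2E; rewrite /opR.
have sI e1 e2 H (se1 : smoothr e1) (se2 : smoothr e2) :
    smoothr (integrand v Gam e1 e2 (Ref H) (Imf H)) :=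
  smoothr_integrand v sGam se1 se2 (smoothr_Ref H) (smoothr_Imf H).
have E : integrand v Gam c1 c2 (Ref (c *: F + G)) (Imf (c *: F + G)) =
  (fun z => 1 * (complex.Re c * integrand v Gam c1 c2 (Ref F) (Imf F) z +
    t * complex.Im c * integrand v Gam d1 d2 (Ref F) (Imf F) z) +
    1 * integrand v Gam c1 c2 (Ref G) (Imf G) z).
  by apply/funext => z; rewrite /integrand RefL ImfL c1E c2E; ring.
have sF := smoothrD (smoothrM (smoothr_cst (complex.Re c)) (sI _ _ F s1 s2))
  (smoothrM (smoothr_cst (t * complex.Im c)) (sI _ _ F t1 t2)).
rewrite E (pint_lin 1 1 x sF (sI _ _ G s1 s2)).
by rewrite (pint_lin _ _ x (sI _ _ F s1 s2) (sI _ _ F t1 t2)); ring.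
Qed.

Lemma solve_linear : linear solve.
Proof.
have sc := smoothr_ecos v la mu sGam; have ss := smoothr_esin v la mu sGam.
have sn := smoothrN ss.
move=> c F G; apply: smoothfun_eqP => x.
  rewrite RefL; apply: etrans (opR_complex_lin (t := -1) c F G x sc sn ss sc _ _) _.
  - by move=> z; ring.
  - by move=> z; ring.
  - by rewrite mulN1r mulNr.
rewrite ImfL; apply: etrans (opR_complex_lin (t := 1) c F G x ss sc sc sn _ _) _.
- by move=> z; ring.
- by move=> z; ring.
- by rewrite mul1r.
Qed.

HB.instance Definition _ := GRing.isLinear.Build R[i] (smoothfun R n) (smoothfun R n)
  _ solve solve_linear.

(** The coefficients v_j are real and act on each part separately, so the two parts of the equation
    are [ode_Re] and [ode_Im]. *)
Lemma solve_eq F : \sum_(j < n) (v 0 j)%:C *: sD j (solve F) - lambda *: solve F = F.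
Proof.
have sumE (f : smoothfun R n -> R) : {morph f : F G / F + G >-> F + G} -> f 0 = 0 ->
    f (\sum_(j < n) (v 0 j)%:C *: sD j (solve F)) =
    \sum_(j < n) f ((v 0 j)%:C *: sD j (solve F)).
  by move=> fD f0; exact: big_morph.
have tF1 := smoothr_Ref F; have tF2 := smoothr_Imf F.
have RefZ (c : R[i]) G x : Ref (c *: G) x = complex.Re c * Ref G x - complex.Im c * Imf G x.
  by rewrite -[c *: G]addr0 RefL [Ref 0 x]/(0 : R) addr0.
have ImfZ (c : R[i]) G x : Imf (c *: G) x = complex.Re c * Imf G x + complex.Im c * Ref G x.
  by rewrite -[c *: G]addr0 ImfL [Imf 0 x]/(0 : R) addr0.
rewrite addrC -scaleNr; apply: smoothfun_eqP => x.
  rewrite RefL (sumE (fun G => Ref G x)) //; last first.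
    by move=> G H; rewrite -[G]scale1r RefL /= mul1r mul0r subr0 scale1r.
  under eq_bigr => j _ do rewrite RefZ /= mul0r subr0.
  have := ode_Re la mu v0 sGam x tF1 tF2.
  rewrite -[opRe _ _ _ _ _ _]/(Ref (solve F)) => ->.
  rewrite -[opIm _ _ _ _ _ _ x]/(Imf (solve F) x).
  by rewrite /la /mu; case: (lambda) => a b /=; ring.
rewrite ImfL (sumE (fun G => Imf G x)) //; last first.
  by move=> G H; rewrite -[G]scale1r ImfL /= mul1r mul0r addr0 scale1r.
under eq_bigr => j _ do rewrite ImfZ /= mul0r addr0.
have := ode_Im la mu v0 sGam x tF1 tF2.
rewrite -[opIm _ _ _ _ _ _]/(Imf (solve F)) => ->.
rewrite -[opRe _ _ _ _ _ _ x]/(Ref (solve F) x).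
by rewrite /la /mu; case: (lambda) => a b /=; ring.
Qed.

Lemma solve_bound k A : compact A -> exists2 B, 0 <= B & forall F e, 0 <= e ->
  cjet_le k (rays v Gam A) e F -> cjet_le k A (B * e) (solve F).
Proof.
move=> cA; have sc := smoothr_ecos v la mu sGam; have ss := smoothr_esin v la mu sGam.
have [B1 B10 b1] := jet_le_opR v sGam k cA sc (smoothrN ss).
have [B2 B20 b2] := jet_le_opR v sGam k cA ss sc.
exists (B1 + B2); first exact: addr_ge0.
move=> F e e0 [bF1 bF2].
have tF1 := smoothr_Ref F; have tF2 := smoothr_Imf F.
split; rewrite mulrDl.
  apply: (jet_le_sub _ _ (b1 _ _ e tF1 tF2 e0 bF1 bF2)) => //.
  by rewrite lerDl mulr_ge0.
apply: (jet_le_sub _ _ (b2 _ _ e tF1 tF2 e0 bF1 bF2)) => //.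
by rewrite lerDr mulr_ge0.
Qed.

End Solution.

(** * Normal sets and the right inverse *)

Lemma normal_rays (R : realType) (n : nat) (v : 'rV[R]_n) (K H : set 'rV[R]_n)
    (phi psi : H -> R) (Gam : 'rV[R]_n -> R) :
  v != 0 -> normal_data v K phi psi ->
  (forall x : H, phi x <= Gam (\val x) <= psi x) -> rays v Gam K `<=` K.
Proof.
move=> v0 [_ Hv _ KE] G01 _ [_ [[u y] /= [u01 Ky] <-] <-].
rewrite /= in_itv /= in u01.
move: Ky; rewrite KE => -[x [t [tx_ yE]]].
have hx : height v (\val x) = 0.
  by rewrite /height (Hv _ (set_mem (valP x))) mul0r.
have dy : offset v Gam y = t - Gam (\val x).
  by rewrite yE offset_line // /offset /foot hx scale0r subr0 sub0r.
(* The new coordinate is (1 - u) t + u Gam(x), a convex combination of two points of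
   [phi x, psi x]. *)
exists x, (t - u * (t - Gam (\val x))); split; last first.
  rewrite /ray /depth space_tx time_tx dy {1}yE.
  by rewrite addrAC -scalerBl.
have /andP[g1 g2] := G01 x; case/andP: tx_ => t1 t2; case/andP: u01 => u0 u1.
by apply/andP; split; nra.
Qed.

Theorem theorem3p1 (R : realType) (n : nat) (lambda : R[i])
    (v : 'rV[R]_n) (K : set 'rV[R]_n) :
  v != 0 -> compact K -> vnormal_smooth v K ->
  exists S : {linear whitney K -> whitney K},
    continuous (S : whitney K -> whitney K) /\
    forall f : whitney K,
      \sum_(j < n) (v 0 j)%:C *: wD j (S f) - lambda *: S f = f.
Proof.
move=> v0 cK [H [phi [psi [nd [gamma gammaP]]]]].
have [G GE] := rK_surj gamma.
have sG := smoothr_Ref G.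
have rays_K : rays v (Ref G) K `<=` K.
  apply: (normal_rays v0 nd) => x.
  have := gammaP x; rewrite -GE /= /restr /cmpartial.
  rewrite /mpartial (_ : foldr _ _ _ = Ref G); last first.
    by elim: (enum _) => //= j s ->; rewrite ffunE.
  (* An inequality in [R[i]] contains the inequality of the real parts. *)
  by rewrite !lecE /= => /andP[/andP[_ ->] /andP[_ ->]].
pose L : {linear smoothfun R n -> smoothfun R n} := solve v lambda sG.
have cL : continuous L.
  apply: bounded_continuous => k A cA.
  have [B B0 bB] := solve_bound v lambda sG k cA.
  by exists (rays v (Ref G) A), B; split=> //; exact: compact_rays.
have flat F : rK K F = 0 -> rK K (L F) = 0.
  move=> /rK_eq0 F0; apply/rK_eq0 => k.
  have [B _ bB] := solve_bound v lambda sG k cK.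
  (* Flatness is the bound with e = 0: F is flat on K, hence on the rays issuing from K, and so its
     image is flat on K. *)
  rewrite -(mulr0 B); apply: bB => //.
  by have [bF1 bF2] := F0 k; split; apply: jet_le_sub (rays_K) (lexx 0) _.
have [S cS SE] := whitney_descent cL flat.
exists S; split=> // f; have [F <-] := rK_surj f.
rewrite SE; under eq_bigr do rewrite wD_rK -linearZ.
rewrite -linear_sum -linearZ -linearB.
by congr (rK K _); exact: solve_eq.
Qed.
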